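(* Consider the DAPI-controlled system $\mathcal{S}^{\mathrm{DAPI}}$ and the CAPI-controlled system $\mathcal{S}^{\mathrm{CAPI}}$ defined in the context, with performance output $y=\mathcal{L}_G^{1/2}\theta$, and suppose that $\mathcal{L}_G=\alpha\mathcal{L}_B$, $T=\tau I$, $Q=qI$, $K=kI$ and $\mathcal{L}_C=\gamma\mathcal{L}_B$ with constants $\alpha,\tau,q,k,\gamma>0$. Let $0=\lambda_1<\lambda_2\le\dots\le\lambda_n$ be the eigenvalues of $\mathcal{L}_B$ and set $$\varphi(\lambda_i,\gamma,k,q,\tau):=\frac{kq^2\lambda_i+q\gamma\lambda_i+\tau(\gamma\lambda_i)^2}{q+\tau\gamma\lambda_i}.$$ Then the squared $\mathcal{H}_2$ norm of the DAPI-controlled system is $$\|\mathcal{S}^{\mathrm{DAPI}}\|_2^2=\|\mathcal{S}^{\mathrm{DAPI}}_P\|_2^2+\|\mathcal{S}^{\mathrm{DAPI}}_\eta\|_2^2,$$ where $$\|\mathcal{S}^{\mathrm{DAPI}}_P\|_2^2=\frac{\alpha}{2k}\sum_{i=2}^n\frac{1}{1+\varphi(\lambda_i,\gamma,k,q,\tau)^{-1}}$$ are the expected power losses associated with the power injection noise $P$, and $$\|\mathcal{S}^{\mathrm{DAPI}}_\eta\|_2^2=\varepsilon^2\frac{\alpha}{2k}\sum_{i=2}^n\frac{1}{\gamma\lambda_i}\cdot\frac{1}{1+\varphi(\lambda_i,\gamma,k,q,\tau)}$$ are the expected power losses associated with the frequency measurement noise $\eta$. The squared $\mathcal{H}_2$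 norm of the CAPI-controlled system is $$\|\mathcal{S}^{\mathrm{CAPI}}\|_2^2=\|\mathcal{S}^{\mathrm{CAPI}}_P\|_2^2=\frac{\alpha}{2k}(n-1),$$ and it is independent of the measurement noise $\eta$.
   Context: Network: $\mathcal{G}^P=(\mathcal{V},\mathcal{E}^P)$ is a connected undirected graph with node set $\mathcal{V}=\{1,\dots,n\}$, $n\ge 2$. Each edge $(i,j)$ carries symmetric weights $b_{ij}=b_{ji}>0$ (susceptance) and $g_{ij}=g_{ji}>0$ (conductance); for non-edges these are zero. For a graph with symmetric edge weights $\mathrm{w}_{ij}$, its weighted Laplacian $\mathcal{L}_W$ is given by $[\mathcal{L}_W]_{ij}=-\mathrm{w}_{ij}$ for $i\ne j$ and $[\mathcal{L}_W]_{ii}=\sum_{j\neq i}\mathrm{w}_{ij}$. $\mathcal{L}_B$ and $\mathcal{L}_G$ are the weighted Laplacians of $\mathcal{G}^P$ with weights $b_{ij}$ and $g_{ij}$. $\mathcal{L}_C$ is the weighted Laplacian of a communication graph $\mathcal{G}^C$ on $\mathcal{V}$ with weights $c_{ij}=c_{ji}>0$ on its edges. The standing assumptions are: (1) $\alpha:=g_{ij}/b_{ij}$ is the same for all edges, so $\mathcal{L}_G=\alpha\mathcal{L}_B$; (2) uniform parameters $T=\tau I$, $Q=qI$, $K=kI$; (3) $\mathcal{G}^C=\mathcal{G}^P$ with $c_{ij}=\gamma b_{ij}$, so $\mathcal{L}_C=\gamma\mathcal{L}_B$. Let $\varepsilon>0$, and let $w$ be a white noise process in $\mathbb{R}^{2n}$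 with $\mathbb{E}\{w(t')w(t)^\top\}=\delta(t-t')I$. The first $n$ components of $w$ represent the power injection noise $P$; $\varepsilon$ times the last $n$ components represents the frequency measurement noise $\eta$. DAPI system $\mathcal{S}^{\mathrm{DAPI}}$ (states $\theta,\omega,\Omega\in\mathbb{R}^n$): $$\begin{bmatrix} \dot\theta \\ T\dot\omega \\ Q\dot\Omega \end{bmatrix}=\begin{bmatrix} 0&I&0 \\ -K\mathcal{L}_B&-I&I \\ 0&-I&-\mathcal{L}_C \end{bmatrix}\begin{bmatrix} \theta \\ \omega \\ \Omega \end{bmatrix}+\begin{bmatrix} 0&0 \\ I&0 \\ 0&\varepsilon I \end{bmatrix}w.$$ CAPI system $\mathcal{S}^{\mathrm{CAPI}}$ (states $\theta,\omega\in\mathbb{R}^n$, $\Omega\in\mathbb{R}$; $\mathbf{1}$ is the all-ones vector): $$\begin{bmatrix} \dot\theta \\ T\dot\omega \\ q\dot\Omega \end{bmatrix}=\begin{bmatrix} 0&I&0 \\ -K\mathcal{L}_B&-I&\mathbf{1} \\ 0&-\frac1n\mathbf{1}^\top&0 \end{bmatrix}\begin{bmatrix} \theta \\ \omega \\ \Omega \end{bmatrix}+\begin{bmatrix} 0&0 \\ I&0 \\ 0&\varepsilon\mathbf{1}^\top \end{bmatrix}w.$$ The output of both systems is $y=\mathcal{L}_G^{1/2}\theta$, with $\mathcal{L}_G^{1/2}$ the unique positive semidefinite square root of $\mathcal{L}_G$. For an input-output stable system $\mathcal{S}$ (from $w$ to $y$) the squared $\mathcal{H}_2$ norm satisfies $\|\mathcal{S}\|_2^2=\lim_{t\to\infty}\mathbb{E}\{y(t)^\top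 y(t)\}$ under the white noise input $w$; it is interpreted as the expected power losses. $\mathcal{S}_P$ and $\mathcal{S}_\eta$ denote the system restricted to the input channel consisting of the first $n$, respectively the last $n$, components of $w$ (the factor $\varepsilon$ being kept in the input matrix). *)

(* Defs.v *)
From HB Require Import structures.
From mathcomp Require Import all_boot all_order all_algebra.
From mathcomp Require Import all_classical all_reals all_analysis.

Set Implicit Arguments.
Unset Strict Implicit.
Unset Printing Implicit Defensive.

Import Order.TTheory GRing.Theory Num.Theory.
Import numFieldNormedType.Exports.

Local Open Scope classical_set_scope.
Local Open Scope ring_scope.

Definition simple_graph (V : finType) (E : rel V) : Prop :=
  symmetric E /\ irreflexive E.

Definition connected_graph (V : finType) (E : rel V) : Prop :=
  forall i j : V, connect E i j.

Definition edge_weights (R : realType) (n : nat) (E : rel 'I_n)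
    (W : 'M[R]_n) : Prop :=
  [/\ W^T = W,
      forall i j, E i j -> 0 < W i j
    & forall i j, ~~ E i j -> W i j = 0].

Definition laplacian (R : realType) (n : nat) (W : 'M[R]_n) : 'M[R]_n :=
  \matrix_(i, j) (if i == j then \sum_(k < n | k != i) W i k else - W i j).

Definition possemidef (R : realType) (n : nat) (S : 'M[R]_n) : Prop :=
  S^T = S /\ forall x : 'cV[R]_n, 0 <= (x^T *m S *m x) 0 0.

Definition psd_sqrt (R : realType) (n : nat) (L S : 'M[R]_n) : Prop :=
  possemidef S /\ S *m S = L.

(* l 1 <= ... <= l n are the eigenvalues of A, counted with multiplicity;
   only the values of l at 1, ..., n matter. *)
Definition ordered_spectrum (R : realType) (n : nat) (A : 'M[R]_n)
    (l : nat -> R) : Prop :=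
  char_poly A = \prod_(1 <= i < n.+1) ('X - (l i)%:P) /\
  forall i j : nat, (1 <= i)%N -> (i <= j)%N -> (j <= n)%N -> l i <= l j.

Definition expmx (R : realType) (N : nat) (A : 'M[R]_N) : 'M[R]_N :=
  \matrix_(i, j) limn (series (fun k : nat => (A ^+ k) i j / k`!%:R)).

(* x' = A x + B w, y = C x with N states, m inputs and p outputs *)
Record lti (R : realType) (N m p : nat) := Lti {
  stA : 'M[R]_N;
  inB : 'M[R]_(N, m);
  outC : 'M[R]_(p, N) }.

(* M x' = A x + B w, y = C x, for an invertible matrix M *)
Definition descriptor (R : realType) (N m p : nat) (M A : 'M[R]_N)
    (B : 'M[R]_(N, m)) (C : 'M[R]_(p, N)) : lti R N m p :=
  Lti (invmx M *m A) (invmx M *m B) C.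

Definition channel1 (R : realType) (N m1 m2 p : nat)
    (S : lti R N (m1 + m2) p) : lti R N m1 p :=
  Lti (stA S) (lsubmx (inB S)) (outC S).

Definition channel2 (R : realType) (N m1 m2 p : nat)
    (S : lti R N (m1 + m2) p) : lti R N m2 p :=
  Lti (stA S) (rsubmx (inB S)) (outC S).

Definition impulse_response (R : realType) (N m p : nat) (S : lti R N m p)
    (t : R) : 'M[R]_(p, m) :=
  outC S *m expmx (t *: stA S) *m inB S.

(* Squared H2 norm: the integral over [0, +oo[ of the squared Frobenius norm
   of the impulse response; it is +oo if the integral diverges. *)
Definition sq_h2norm (R : realType) (N m p : nat) (S : lti R N m p) : \bar R :=
  (\int[@lebesgue_measure R]_(t in `[0%R, +oo[)
     (\sum_(i < p) \sum_(j < m) (impulse_response S t i j) ^+ 2)%R%:E)%E.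

Definition square_integrable (R : realType) (f : R -> R) : Prop :=
  measurable_fun setT f /\
  (@lebesgue_measure R).-integrable setT (fun s => (f s ^+ 2)%:E).

(* White noise is a generalized process: w j f stands for the integral of
   f(s) w_j(s) ds over the time axis, for a square integrable f. Then
   E{w(t') w(t)^T} = delta(t - t') I means that
   E{(w i f) (w j g)} is the integral of f g if i = j and 0 otherwise.
   Linearity of w in f (almost surely) follows from this isometry. *)
Definition white_noise (R : realType) (m : nat) (d : measure_display)
    (T : measurableType d) (P : probability T R)
    (w : 'I_m -> (R -> R) -> {RV P >-> R}) : Prop :=
  forall (i j : 'I_m) (f g : R -> R),
    square_integrable f -> square_integrable g ->
    ('E_P[fun x : T => (w i f x * w j g x)%R])%E =
    if i == j then (\int[@lebesgue_measure R]_s (f s * g s)%R%:E)%E else 0%E.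

(* y(t) = \int_0^t C e^{(t - s) A} B w(s) ds, the response from the zero
   initial state *)
Definition response (R : realType) (N m p : nat) (S : lti R N m p)
    (d : measure_display) (T : measurableType d) (P : probability T R)
    (w : 'I_m -> (R -> R) -> {RV P >-> R}) (t : R) (i : 'I_p) (x : T) : R :=
  \sum_(j < m)
    w j (fun s => \1_(`[0, t]%classic : set R) s *
                  impulse_response S (t - s) i j) x.

(* E{y(t)^T y(t)} tends to l as t -> +oo, for every white noise input *)
Definition expected_power (R : realType) (N m p : nat) (S : lti R N m p)
    (l : R) : Prop :=
  forall (d : measure_display) (T : measurableType d) (P : probability T R)
    (w : 'I_m -> (R -> R) -> {RV P >-> R}),
  white_noise w ->
  ('E_P[fun x : T => (\sum_(i < p) (response S w t i x) ^+ 2)%R])%E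
    @[t --> +oo%R] --> l%:E.

Definition block_mx3 (R : Type) (m1 m2 m3 n1 n2 n3 : nat)
    (A11 : 'M[R]_(m1, n1)) (A12 : 'M[R]_(m1, n2)) (A13 : 'M[R]_(m1, n3))
    (A21 : 'M[R]_(m2, n1)) (A22 : 'M[R]_(m2, n2)) (A23 : 'M[R]_(m2, n3))
    (A31 : 'M[R]_(m3, n1)) (A32 : 'M[R]_(m3, n2)) (A33 : 'M[R]_(m3, n3)) :
    'M[R]_(m1 + (m2 + m3), n1 + (n2 + n3)) :=
  col_mx (row_mx A11 (row_mx A12 A13))
    (col_mx (row_mx A21 (row_mx A22 A23))
            (row_mx A31 (row_mx A32 A33))).

(* The state is (theta, omega, Omega), the input is (P, eta / eps). *)
Definition dapi (R : realType) (n : nat) (T Q K LB LC LGhalf : 'M[R]_n)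
    (eps : R) : lti R (n + (n + n)) (n + n) n :=
  descriptor
    (block_mx3 1%:M 0 0
               0    T 0
               0    0 Q)
    (block_mx3 0            1%:M      0
               (- (K *m LB)) (- 1%:M) 1%:M
               0            (- 1%:M)  (- LC))
    (col_mx (row_mx 0 0)
      (col_mx (row_mx 1%:M 0)
              (row_mx 0 eps%:M)))
    (row_mx LGhalf (row_mx 0 0)).

Definition capi (R : realType) (n : nat) (T K LB LGhalf : 'M[R]_n)
    (q eps : R) : lti R (n + (n + 1)) (n + n) n :=
  descriptor
    (block_mx3 1%:M 0 0
               0    T 0
               0    0 q%:M)
    (block_mx3 0             1%:M                       0
               (- (K *m LB)) (- 1%:M)                   (const_mx 1)
               0             (- (n%:R^-1 *: const_mx 1)) 0)
    (col_mx (row_mx 0 0)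
      (col_mx (row_mx 1%:M 0)
              (row_mx 0 (eps *: const_mx 1))))
    (row_mx LGhalf (row_mx 0 0)).

Definition phi (R : realType) (l gamma k q tau : R) : R :=
  (k * q ^+ 2 * l + q * gamma * l + tau * (gamma * l) ^+ 2)
    / (q + tau * gamma * l).

(* Main.v *)
Require Import Defs.
From HB Require Import structures.
From mathcomp Require Import all_boot all_order all_algebra.
From mathcomp Require Import all_classical all_reals all_analysis.
From mathcomp Require Import measurable_realfun ring lra.

(** In the orthonormal eigenbasis of the Laplacian of b, all blocks of the
    closed loop become diagonal, and the system falls apart into one mode per
    eigenvalue lambda_i:
      th' = om,
      tau om' = - k lambda_i th - om + Om,
      q Om' = - om - gamma lambda_i Om.
    The output energy is the sum over i of alpha lambda_i th_i^2. The mode of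
    lambda_1 = 0 is not asymptotically stable, but it is invisible in the output.
    Every other mode is exponentially stable [coupled_mode_cvg0], and there is a quadratic
    form V of its state with V' = - th^2, so that the integral of th^2 is the
    initial value of V [coupled_mode_energy]. An impulse in the power injection
    starts a mode at om = 1 / tau, one in the measurement noise at Om = eps / q,
    and these two values of V, times alpha lambda_i, are the summands of the two
    sums [mode_loss_power, mode_loss_measurement].

    The centralized controller only uses the average frequency and only pushes
    along the constant vector, which is orthogonal to all eigenvectors but the
    first. It therefore leaves every visible mode a free oscillator
    tau th'' + th' + k lambda_i th = P, which the measurement noise does not
    reach, and for which the integral of th^2 after a unit impulse is
    1 / (2 k lambda_i).

    Adding up the modes gives a function V whose derivative is minus the squared
    norm of the impulse response and which tends to 0 [modal_storage]. Then the
    squared H2 norm is V 0 by the fundamental theorem of calculus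
    [sq_h2norm_energy]. For white noise, the isometry property shows that the
    output power at time t is the same integral cut off at time t, namely
    V 0 - V t, and so tends to V 0 as well [expected_power_energy].

    The eigenbasis comes from [laplacian_modes], and the state trajectories from
    termwise differentiation of the exponential series [is_derive_expmx]. *)

Set Implicit Arguments.
Unset Strict Implicit.
Unset Printing Implicit Defensive.

Import Order.TTheory GRing.Theory Num.Theory.
Import numFieldNormedType.Exports.

Local Open Scope classical_set_scope.
Local Open Scope ring_scope.

(** * The matrix exponential *)

Lemma cvg_sumr (R : realType) (T : Type) (F : set_system T) (FF : Filter F)
    (I : finType) (D : pred I) (f : I -> T -> R) (l : I -> R) :
  (forall i, D i -> f i x @[x --> F] --> l i) ->
  (\sum_(i | D i) f i x) @[x --> F] --> \sum_(i | D i) l i.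
Proof.
move=> fl; apply: cvg_big => //; exact: (@add_continuous R^o).
Qed.

(** The sum of the absolute values of all entries dominates every absolute row
    sum, so each further factor A costs at most one factor of that sum. *)
Lemma normr_mx_exp_entry (R : realType) N (A : 'M[R]_N) (k : nat) i j :
  `|(A ^+ k) i j| <= (\sum_(a < N) \sum_(b < N) `|A a b|) ^+ k.
Proof.
set M := \sum_a _.
have M0 : 0 <= M by rewrite sumr_ge0// => a _; rewrite sumr_ge0.
elim: k i j => [|k IH] i j.
  by rewrite !expr0 mxE; case: (i == j); rewrite ?normr1 ?normr0.
rewrite !exprS mxE (le_trans (ler_norm_sum _ _ _))//.
apply: (@le_trans _ _ (\sum_(l < N) `|A i l| * M ^+ k)).
  by apply: ler_sum => l _; rewrite normrM ler_wpM2l.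
rewrite -mulr_suml ler_wpM2r ?exprn_ge0//.
rewrite /M [leRHS](bigD1 i)//= lerDl sumr_ge0// => a _.
by rewrite sumr_ge0.
Qed.

(** Each entry of expmx (t *: A) is a scalar power series in t; these are its
    coefficients, so that power series can be differentiated termwise. *)
Definition expmx_coef (R : realType) N (A : 'M[R]_N) i j : nat -> R :=
  fun k => (A ^+ k) i j / k`!%:R.

Lemma is_cvg_expmx (R : realType) N (A : 'M[R]_N) i j t :
  cvgn (pseries (expmx_coef A i j) t).
Proof.
set M := \sum_(a < N) \sum_(b < N) `|A a b|.
have M0 : 0 <= M by rewrite sumr_ge0// => a _; rewrite sumr_ge0.
apply: (@normed_cvg R R^o).
apply: series_le_cvg (is_cvg_series_exp_coeff (M * `|t|)) => [k|k|k] /=.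
- by [].
- by rewrite /exp_coeff divr_ge0// exprn_ge0// mulr_ge0.
- rewrite /expmx_coef /exp_coeff /= !normrM normfV normr_nat normrX exprMn.
  by rewrite mulrAC ler_wpM2r ?invr_ge0// ler_wpM2r ?exprn_ge0// normr_mx_exp_entry.
Qed.

Lemma expmxE (R : realType) N (A : 'M[R]_N) i j t :
  expmx (t *: A) i j = limn (pseries (expmx_coef A i j) t).
Proof.
rewrite mxE /pseries /expmx_coef; congr (limn (series _)); apply/funext => k.
suff -> : (t *: A) ^+ k = t ^+ k *: A ^+ k by rewrite mxE -mulrA mulrC.
elim: k => [|k IH]; first by rewrite !expr0 scale1r.
by rewrite !exprS IH -mulmxE -scalemxAl -scalemxAr scalerA.
Qed.

(** Termwise differentiation shifts A ^+ k to A ^+ k.+1 = A * A ^+ k. The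
    differentiated series is thus a combination of entry series of the same
    kind, which settles both its convergence and its sum. *)
Lemma pseries_diffs_expmx (R : realType) N (A : 'M[R]_N) i j :
  pseries_diffs (expmx_coef A i j) =
  fun k => \sum_(l < N) A i l * expmx_coef A l j k.
Proof.
apply/funext => k; rewrite /pseries_diffs /expmx_coef exprS mxE.
rewrite mulr_suml mulr_sumr; apply: eq_bigr => l _.
have k0 : k.+1%:R != 0 :> R by rewrite pnatr_eq0.
by rewrite factS natrM invfM mulrCA mulVKf// mulrA.
Qed.

Lemma cvg_pseries_sum (R : realType) N (a : 'I_N -> R) (c : 'I_N -> nat -> R) t :
  (forall l, cvgn (pseries (c l) t)) ->
  pseries (fun k => \sum_(l < N) a l * c l k) t n @[n --> \oo] -->
  \sum_(l < N) a l * limn (pseries (c l) t).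
Proof.
move=> cc.
have -> : pseries (fun k => \sum_(l < N) a l * c l k) t =
    fun n => \sum_(l < N) a l * pseries (c l) t n.
  apply/funext => n; rewrite /pseries /series /=.
  under eq_bigr do rewrite mulr_suml.
  rewrite exchange_big; apply: eq_bigr => l _; rewrite mulr_sumr.
  by apply: eq_bigr => k _; rewrite mulrA.
by apply: cvg_sumr => l _; apply: cvgMl_tmp; exact: cc.
Qed.

Lemma is_derive_expmx (R : realType) N (A : 'M[R]_N) i j (t : R) :
  is_derive t (1 : R) (fun s => expmx (s *: A) i j)
    ((A *m expmx (t *: A)) i j).
Proof.
have cc l : cvgn (pseries (expmx_coef A l j) (`|t| + 1)) by exact: is_cvg_expmx.
have -> : (fun s => expmx (s *: A) i j) =
    (fun s => limn (pseries (expmx_coef A i j) s)).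
  by apply/funext => s; exact: expmxE.
suff <- : limn (pseries (pseries_diffs (expmx_coef A i j)) t) =
    (A *m expmx (t *: A)) i j.
  apply: (@pseries_snd_diffs R _ (`|t| + 1)).
  - exact: cc.
  - rewrite pseries_diffs_expmx; apply/cvg_ex; eexists; exact: cvg_pseries_sum.
  - rewrite pseries_diffs_expmx.
    have -> : pseries_diffs (fun k => \sum_(l < N) A i l * expmx_coef A l j k) =
       fun k => \sum_(l < N) A i l * pseries_diffs (expmx_coef A l j) k.
      apply/funext => k; rewrite /pseries_diffs mulr_sumr; apply: eq_bigr => l _.
      by rewrite mulrCA.
    apply/cvg_ex; eexists; apply: cvg_pseries_sum => l.
    rewrite pseries_diffs_expmx; apply/cvg_ex; eexists; exact: cvg_pseries_sum.
  - by rewrite [ltRHS]ger0_norm ?addr_ge0// ltrDl.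
rewrite pseries_diffs_expmx.
have -> : (A *m expmx (t *: A)) i j =
   \sum_(l < N) A i l * limn (pseries (expmx_coef A l j) t).
  by rewrite mxE; apply: eq_bigr => l _; rewrite expmxE.
by apply: cvg_lim => //; apply: cvg_pseries_sum => l; exact: is_cvg_expmx.
Qed.

Lemma expmx0 (R : realType) N (A : 'M[R]_N) : expmx (0 *: A) = 1%:M.
Proof.
apply/matrixP => i j; rewrite expmxE.
apply: cvg_lim => //; apply: cvg_near_cst; near=> n.
rewrite /pseries /series /= -(prednK (_ : 0 < n)%N); last by near: n; exists 1%N.
rewrite big_nat_recl//= big1 ?addr0; last by move=> k _; rewrite exprS mul0r mulr0.
by rewrite expr0 mulr1 /expmx_coef expr0 fact0 divr1.
Unshelve. all: by end_near. Qed.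

(** The form used below: P is a row of modal coordinates, and B sets the initial
    states, so this is the evolution equation of a modal coordinate. *)
Lemma is_derive_mul_expmx (R : realType) N p m (P : 'M[R]_(p, N)) (A : 'M[R]_N)
    (B : 'M[R]_(N, m)) i j (t : R) :
  is_derive t (1 : R) (fun s => (P *m expmx (s *: A) *m B) i j)
    ((P *m A *m expmx (t *: A) *m B) i j).
Proof.
have E (X : 'M[R]_N) : (P *m X *m B) i j =
    \sum_(a < N) \sum_(b < N) P i b * B a j * X b a.
  rewrite mxE; apply: eq_bigr => a _; rewrite mxE mulr_suml.
  by apply: eq_bigr => b _; ring.
have -> : (fun s => (P *m expmx (s *: A) *m B) i j) =
    \sum_(a < N) \sum_(b < N) ((P i b * B a j) \*: (fun s => expmx (s *: A) b a)).
  apply/funext => s; rewrite E fct_sumE; apply: eq_bigr => a _.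
  by rewrite fct_sumE.
rewrite -(mulmxA P) E; apply: is_derive_sum => a; apply: is_derive_sum => b.
apply: is_deriveZ; exact: is_derive_expmx.
Qed.

(** * Decay and energy of a coupled mode *)

(** The differential inequality makes expR (mu * t) * W t nonincreasing. *)
Lemma exponential_decay (R : realType) (W dW : R -> R) (mu : R) :
  0 < mu -> (forall t, is_derive t (1 : R) W (dW t)) ->
  (forall t, 0 <= W t) -> (forall t, dW t <= - mu * W t) ->
  W t @[t --> +oo] --> (0 : R).
Proof.
move=> mu0 WdW W0 dWle.
pose G t := expR (mu * t) * W t.
have dG t : is_derive t (1 : R) G (expR (mu * t) * (mu * W t + dW t)).
  have dm : is_derive t (1 : R) ( *%R mu) mu.
    have -> : *%R mu = mu \*: id by [].
    by apply: is_derive_eq; rewrite /GRing.scale /= mulr1.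
  have de : is_derive t (1 : R) (fun s => expR (mu * s)) (expR (mu * t) * mu).
    by apply: is_derive_eq; rewrite /GRing.scale /= mulrC.
  have dWt := WdW t.
  have -> : G = (fun s => expR (mu * s)) * W by [].
  by apply: is_derive_eq; rewrite /GRing.scale /=; ring.
have Gle t : 0 <= t -> G t <= G 0.
  move=> t0; apply: (@ler0_derive1_le_cc _ G 0 t) => //.
  - move=> x _; rewrite derive1E derive_val.
    by rewrite mulr_ge0_le0 ?expR_ge0// -lerBrDl sub0r -mulNr dWle.
  - apply: continuous_subspaceT => x.
    by apply/differentiable_continuous/derivable1_diffP; apply: ex_derive.
  - by rewrite in_itv /= t0 lexx.
  - by rewrite in_itv /= lexx t0.
have Wle t : 0 <= t -> W t <= W 0 * expR (- (mu * t)).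
  move=> /Gle; rewrite /G mulr0 expR0 mul1r expRN => h.
  by rewrite ler_pdivlMr ?expR_gt0// mulrC.
apply: (@squeeze_cvgr _ _ _ _ (cst 0) (fun t => W 0 * expR (- (mu * t)))).
- near=> t; rewrite /cst W0 /= Wle//; near: t; exact: nbhs_pinfty_ge.
- exact: cvg_cst.
- rewrite -[X in _ --> X](mulr0 (W 0)); apply: cvgMl_tmp.
  apply: (@cvg_comp _ _ _ (fun t => mu * t) (fun t => expR (- t)) _
    (pinfty_nbhs R)); last exact: cvgr_expR.
  apply: gt0_cvgMry => //; exact: cvg_id.
Unshelve. all: by end_near. Qed.

Lemma cvg_sqr0 (R : realType) (f g : R -> R) (c : R) :
  (forall t, f t ^+ 2 <= c * g t) -> g t @[t --> +oo] --> (0 : R) ->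
  f t @[t --> +oo] --> (0 : R).
Proof.
move=> fg g0.
have f2 : (f t ^+ 2) @[t --> +oo] --> (0 : R).
  apply: (@squeeze_cvgr _ _ _ _ (cst 0) (fun t => c * g t)).
  - by near=> t; rewrite /cst sqr_ge0 fg.
  - exact: cvg_cst.
  - by rewrite -[X in _ --> X](mulr0 c); apply: cvgMl_tmp.
have : (Num.sqrt (f t ^+ 2)) @[t --> +oo] --> (0 : R).
  rewrite -[X in _ --> X](@sqrtr0 R).
  exact: (cvg_comp _ _ f2 (@sqrt_continuous R 0)).
under eq_cvg do rewrite sqrtr_sqr.
exact: norm_cvg0.
Unshelve. all: by end_near. Qed.

Lemma exists_pos_le3 (R : realType) (x y z : R) : 0 < x -> 0 < y -> 0 < z ->
  exists d, [/\ 0 < d, d <= x, d <= y & d <= z].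
Proof.
move=> x0 y0 z0; exists (Num.min x (Num.min y z)).
by rewrite !lt_min x0 y0 z0 !ge_min !lexx !orbT.
Qed.

(** One eigenmode of the closed loop: an oscillator with state (th, om) whose
    integral controller Om is attached with strength s. The distributed
    controller gives s = 1. For s = 0 and Om = 0 it is a free damped oscillator,
    which is what the centralized controller leaves of each mode of a positive
    eigenvalue; carrying s as a parameter serves both. *)
Section coupled_mode.
Variables (R : realType) (kap tau q c s : R).
Hypotheses (kap0 : 0 < kap) (tau0 : 0 < tau) (q0 : 0 < q) (c0 : 0 < c).
Hypothesis s1 : s ^+ 2 <= 1.
Variables (th om Om : R -> R).
Hypothesis dth : forall t, is_derive t (1 : R) th (om t).
Hypothesis dom : forall t, is_derive t (1 : R) om
  ((- kap * th t - om t + s * Om t) / tau).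
Hypothesis dOm : forall t, is_derive t (1 : R) Om
  ((- s * om t - c * Om t) / q).

(** Both the Lyapunov function that yields decay and the storage function that
    yields the energy of th are quadratic forms of the state. *)
Lemma is_derive_quadratic a b e f h j t :
  is_derive t (1 : R)
    (fun t => a * th t ^+ 2 + b * (th t * om t) + e * om t ^+ 2 +
       f * (th t * Om t) + h * (om t * Om t) + j * Om t ^+ 2)
    (a * (2 * th t * om t) +
     b * (om t ^+ 2 + th t * ((- kap * th t - om t + s * Om t) / tau)) +
     e * (2 * om t * ((- kap * th t - om t + s * Om t) / tau)) +
     f * (om t * Om t + th t * ((- s * om t - c * Om t) / q)) +
     h * (((- kap * th t - om t + s * Om t) / tau) * Om t +
          om t * ((- s * om t - c * Om t) / q)) +
     j * (2 * Om t * ((- s * om t - c * Om t) / q))).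
Proof.
have -> : (fun t => a * th t ^+ 2 + b * (th t * om t) + e * om t ^+ 2 +
       f * (th t * Om t) + h * (om t * Om t) + j * Om t ^+ 2) =
  a \*: (th ^+ 2) + b \*: (th * om) + e \*: (om ^+ 2) + f \*: (th * Om) +
  h \*: (om * Om) + j \*: (Om ^+ 2) by [].
have d1 := dth t; have d2 := dom t; have d3 := dOm t.
by apply: is_derive_eq; rewrite /GRing.scale /= !expr1; ring.
Qed.

(** The natural energy kap th^2 + tau om^2 + q Om^2 decreases at the rate
    2 om^2 + 2 c Om^2, since the coupling terms in s cancel, but this does not
    control th. Adding a small multiple 2 d tau of th om supplies the missing
    negative term in th^2, so that the modified energy W decays exponentially. *)
Lemma coupled_mode_cvg0 :
  [/\ th t @[t --> +oo] --> (0 : R), om t @[t --> +oo] --> (0 : R) &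
      Om t @[t --> +oo] --> (0 : R)].
Proof.
(* The first two bounds keep W comparable to the natural energy; all three
   let the dissipation absorb the cross terms th om and th Om. *)
have [d [d0 d_tau d_kap d_c]] : exists d, [/\ 0 < d, d <= (4 * tau)^-1,
    d <= kap / 4 & d <= kap * c / 2].
  by apply: exists_pos_le3; rewrite ?invr_gt0 ?divr_gt0 ?mulr_gt0.
have [mu [mu0 mu_d mu_tau mu_c]] : exists mu, [/\ 0 < mu, mu <= d * 2 / 3,
    mu <= (3 / 2 * tau)^-1 & mu <= c / q].
  by apply: exists_pos_le3; rewrite ?invr_gt0 ?divr_gt0 ?mulr_gt0.
pose W t := kap * th t ^+ 2 + (2 * d * tau) * (th t * om t) + tau * om t ^+ 2 +
       0 * (th t * Om t) + 0 * (om t * Om t) + q * Om t ^+ 2.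
have dW t := is_derive_quadratic kap (2 * d * tau) tau 0 0 q t.
have dtau : 4 * d * tau <= 1.
  by move: d_tau; rewrite -[_^-1]mul1r ler_pdivlMr ?mulr_gt0// mulrCA mulrA.
have mutau : mu * (3 / 2 * tau) <= 1.
  by move: mu_tau; rewrite -[_^-1]mul1r ler_pdivlMr ?mulr_gt0//.
have muc : mu * q <= c by move: mu_c; rewrite ler_pdivlMr.
have dd : 4 * d ^+ 2 * tau <= kap by nra.
have Wlow t : kap / 2 * th t ^+ 2 + tau / 2 * om t ^+ 2 + q * Om t ^+ 2 <= W t.
  have : 0 <= tau / 2 * (om t + 2 * d * th t) ^+ 2 +
      (kap - 4 * d ^+ 2 * tau) / 2 * th t ^+ 2.
    by rewrite addr_ge0// mulr_ge0 ?sqr_ge0 ?divr_ge0 ?subr_ge0// ltW.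
  by rewrite /W; lra.
have Wup t : W t <= 3 / 2 * (kap * th t ^+ 2 + tau * om t ^+ 2) + q * Om t ^+ 2.
  have : 0 <= tau / 2 * (om t - 2 * d * th t) ^+ 2 +
      (kap - 4 * d ^+ 2 * tau) / 2 * th t ^+ 2.
    by rewrite addr_ge0// mulr_ge0 ?sqr_ge0 ?divr_ge0 ?subr_ge0// ltW.
  by rewrite /W; lra.
have W0 t : 0 <= W t.
  apply: le_trans (Wlow t).
  by rewrite !addr_ge0// mulr_ge0 ?sqr_ge0 ?divr_ge0// ltW.
have Wcvg : W t @[t --> +oo] --> (0 : R).
  apply: (exponential_decay mu0 dW) => // t.
  set x := th t; set y := om t; set z := Om t.
  apply: (@le_trans _ _ (- (d * kap * x ^+ 2 + y ^+ 2 + c * z ^+ 2))); last first.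
    rewrite mulNr lerN2.
    apply: (@le_trans _ _ (mu * (3 / 2 * (kap * x ^+ 2 + tau * y ^+ 2) + q * z ^+ 2))).
      by rewrite ler_pM2l ?Wup.
    have h1 : mu * (3 / 2) * kap * x ^+ 2 <= d * kap * x ^+ 2.
      by rewrite ler_wpM2r ?sqr_ge0// ler_wpM2r ?(ltW kap0)//; lra.
    have h2 : mu * (3 / 2 * tau) * y ^+ 2 <= 1 * y ^+ 2 by rewrite ler_wpM2r ?sqr_ge0.
    have h3 : mu * q * z ^+ 2 <= c * z ^+ 2 by rewrite ler_wpM2r ?sqr_ge0.
    by lra.
  (* Completing the squares of th om and th Om: the left side is the right side
     minus the three nonnegative quantities h1, h2 and h3. *)
  have h1 : 0 <= d / (2 * kap) * ((kap * x + 2 * y) ^+ 2 + (kap * x - 2 * s * z) ^+ 2).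
    by rewrite mulr_ge0 ?addr_ge0 ?sqr_ge0 ?divr_ge0 ?mulr_ge0// ltW.
  have h2 : 0 <= (1 - 2 * d * tau - 2 * (d / kap)) * y ^+ 2.
    rewrite mulr_ge0 ?sqr_ge0//.
    have : d / kap <= 1 / 4 by rewrite ler_pdivrMr//; lra.
    by lra.
  have h3 : 0 <= (c - 2 * (d / kap) * s ^+ 2) * z ^+ 2.
    rewrite mulr_ge0 ?sqr_ge0//.
    have dk : 2 * (d / kap) <= c by rewrite mulrA ler_pdivrMr//; lra.
    by rewrite subr_ge0 (le_trans _ dk)// ler_piMr// mulr_ge0// divr_ge0// ltW.
  rewrite -subr_ge0.
  apply: le_trans (addr_ge0 (addr_ge0 h1 h2) h3) _.
  rewrite le_eqVlt; apply/orP; left; apply/eqP; field.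
  by rewrite !gt_eqF.
split.
- apply: (@cvg_sqr0 _ _ W (2 / kap)) => // t.
  rewrite mulrAC ler_pdivlMr//.
  have := Wlow t; have : 0 <= tau / 2 * om t ^+ 2 + q * Om t ^+ 2.
    by rewrite addr_ge0// mulr_ge0 ?sqr_ge0 ?divr_ge0// ltW.
  by lra.
- apply: (@cvg_sqr0 _ _ W (2 / tau)) => // t.
  rewrite mulrAC ler_pdivlMr//.
  have := Wlow t; have : 0 <= kap / 2 * th t ^+ 2 + q * Om t ^+ 2.
    by rewrite addr_ge0// mulr_ge0 ?sqr_ge0 ?divr_ge0// ltW.
  by lra.
- apply: (@cvg_sqr0 _ _ W (1 / q)) => // t.
  rewrite mulrAC ler_pdivlMr// mul1r mulrC.
  have := Wlow t; have : 0 <= kap / 2 * th t ^+ 2 + tau / 2 * om t ^+ 2.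
    by rewrite addr_ge0// mulr_ge0 ?sqr_ge0 ?divr_ge0// ltW.
  by lra.
Qed.

(** The integral over [0, +oo[ of th^2 when the mode starts at th = 0,
    om = x, Om = y: the value there of the quadratic form that solves the
    Lyapunov equation of the mode, the observability Gramian of the output th. *)
Definition mode_loss (x y : R) : R :=
  let N := q ^+ 2 * kap + c * q + tau * c ^+ 2 in
  let a := q + tau * c in
  (tau ^+ 2 * N * x ^+ 2 + 2 * s * a * q * tau * (x * y) +
   s ^+ 2 * a * q ^+ 2 / c * y ^+ 2) / (2 * kap * (N + s ^+ 2 * a)).

(** A quadratic form V with V' = - th^2 is found by equating coefficients: six
    linear equations in six unknowns, solvable because the Hurwitz determinant
    D = a1 a2 - a0 a3 of the mode is positive, where a3 = tau q, a2 = q + tau c,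
    a1 = c + kap q + s^2 and a0 = kap c are the coefficients of its
    characteristic polynomial. *)
Lemma coupled_mode_energy : th 0 = 0 ->
  exists V : R -> R, [/\ forall t, is_derive t (1 : R) V (- th t ^+ 2),
    V t @[t --> +oo] --> (0 : R) & V 0 = mode_loss (om 0) (Om 0)].
Proof.
move=> th0.
pose N := q ^+ 2 * kap + c * q + tau * c ^+ 2.
pose a2 := q + tau * c.
pose D := N + s ^+ 2 * a2.
have a20 : 0 < a2 by rewrite addr_gt0 ?mulr_gt0.
have N0 : 0 < N by rewrite !addr_gt0 ?mulr_gt0 ?exprn_gt0.
have D0 : 0 < D by rewrite ltr_wpDr// mulr_ge0 ?sqr_ge0// ltW.
(* The entries of the Gramian; off the diagonal they enter V twice. *)
pose b := tau / (2 * kap).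
pose e := tau ^+ 2 * N / (2 * kap * D).
pose h := s * a2 * q * tau / (2 * kap * D).
pose j := s ^+ 2 * a2 * q ^+ 2 / (2 * kap * c * D).
pose f := q / c * (s / (2 * kap) - h * kap / tau).
pose a := b / tau + e * kap / tau + f * s / q.
exists (fun t => a * th t ^+ 2 + (2 * b) * (th t * om t) + e * om t ^+ 2 +
       (2 * f) * (th t * Om t) + (2 * h) * (om t * Om t) + j * Om t ^+ 2).
have nz : [/\ kap != 0, tau != 0, q != 0, c != 0 & D != 0] by rewrite !gt_eqF.
have [kapn taun qn cn Dn] := nz.
split.
- move=> t; have := is_derive_quadratic a (2 * b) e (2 * f) (2 * h) j t.
  congr is_derive.
  rewrite /a /f /j /h /e /b.
  move: Dn; rewrite /D /N /a2 => Dn; field.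
  by rewrite kapn taun qn cn Dn.
- have [Hth Hom HOm] := coupled_mode_cvg0.
  have -> : (0 : R) = a * 0 ^+ 2 + (2 * b) * (0 * 0) + e * 0 ^+ 2 +
       (2 * f) * (0 * 0) + (2 * h) * (0 * 0) + j * 0 ^+ 2 by ring.
  do 5 (apply: cvgD; last by apply: cvgMl_tmp; exact: cvgM).
  by apply: cvgMl_tmp; exact: cvgM.
- rewrite th0 /mode_loss -/N -/a2 -/D /e /h /j; field.
  by rewrite kapn cn Dn.
Qed.

End coupled_mode.

(** * Squared norm and expected power from a storage function *)

(** The product is dominated by the sum of the two squares. *)
Lemma integrable_mul_sqr (R : realType) (d : measure_display)
    (T : measurableType d) (P : probability T R) (X Y : {RV P >-> R}) :
  P.-integrable setT (fun x => (X x ^+ 2)%:E) ->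
  P.-integrable setT (fun x => (Y x ^+ 2)%:E) ->
  P.-integrable setT (fun x => (X x * Y x)%:E).
Proof.
move=> iX iY; apply: (le_integrable measurableT _ _ (integrableD measurableT iX iY)).
- by apply/measurable_EFinP; apply: measurable_funM.
- move=> x _; rewrite !abse_EFin lee_fin [leRHS]ger0_norm ?addr_ge0 ?sqr_ge0//.
  rewrite normrM -(real_normK (num_real (X x))) -(real_normK (num_real (Y x))).
  have := sqr_ge0 (`|X x| - `|Y x|); have := normr_ge0 (X x); have := normr_ge0 (Y x).
  by nra.
Qed.

Lemma second_moment_uncorrelated (R : realType) (d : measure_display)
    (T : measurableType d) (P : probability T R) (p m : nat)
    (X : 'I_p -> 'I_m -> {RV P >-> R}) (v : 'I_p -> 'I_m -> R) :
  (forall i j j', ('E_P[fun x : T => (X i j x * X i j' x)%R])%E =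
     if j == j' then (v i j)%:E else 0%E) ->
  ('E_P[fun x : T => (\sum_(i < p) (\sum_(j < m) X i j x) ^+ 2)%R] =
    (\sum_(i < p) \sum_(j < m) v i j)%:E)%E.
Proof.
move=> XX.
have i2 i j : P.-integrable setT (fun x => (X i j x ^+ 2)%:E).
  apply/integrableP; split.
    by apply/measurable_EFinP; apply: measurable_funX.
  have := XX i j j; rewrite eqxx unlock => h.
  under eq_integral do rewrite gee0_abs ?lee_fin ?sqr_ge0// expr2.
  by rewrite h ltry.
have im i j j' : P.-integrable setT (fun x => (X i j x * X i j' x)%:E).
  exact: integrable_mul_sqr.
rewrite unlock.
transitivity (\int[P]_w \sum_(i < p) \sum_(j < m) \sum_(j' < m) (X i j w * X i j' w)%:E)%E.
  apply: eq_integral => w _; rewrite -sumEFin; apply: eq_bigr => i _.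
  rewrite expr2 mulr_suml -sumEFin; apply: eq_bigr => j _.
  by rewrite mulr_sumr -sumEFin.
rewrite integral_sum//; last first.
  move=> i; apply: integrable_sum => // j _; exact: integrable_sum.
rewrite -sumEFin; apply: eq_bigr => i _.
rewrite integral_sum//; last by move=> j; exact: integrable_sum.
rewrite -sumEFin; apply: eq_bigr => j _.
rewrite integral_sum//.
rewrite (bigD1 j)//= big1 ?adde0.
  by have := XX i j j; rewrite eqxx unlock.
move=> j' j'j; have := XX i j j'; rewrite unlock eq_sym.
by case: eqVneq j'j.
Qed.

(** V t is the output energy that remains to be released after time t. Knowing
    such a V, both the integral of the squared impulse response and the
    stationary output power are read off at time 0. *)
Section energy.
Variables (R : realType) (N m p : nat) (S : lti R N m p) (V : R -> R).
Let h i j t := impulse_response S t i j.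
Let H t := \sum_(i < p) \sum_(j < m) h i j t ^+ 2.
Hypothesis dV : forall t, is_derive t (1 : R) V (- H t).
Hypothesis V0 : V t @[t --> +oo] --> (0 : R).

Lemma continuous_impulse_response i j : continuous (h i j).
Proof.
move=> t; apply/differentiable_continuous/derivable1_diffP.
by case: (is_derive_mul_expmx (outC S) (stA S) (inB S) i j t).
Qed.

Let continuous_energy : continuous H.
Proof.
move=> t; apply: cvg_sumr => i _; apply: cvg_sumr => j _.
by apply: cvgM; exact: continuous_impulse_response.
Qed.

Let continuous_storage : continuous V.
Proof.
move=> t; apply/differentiable_continuous/derivable1_diffP.
exact: ex_derive.
Qed.

Lemma sq_h2norm_energy : sq_h2norm S = (V 0)%:E.
Proof.
rewrite /sq_h2norm (@ge0_continuous_FTC2y R H (\- V) 0 0).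
- by rewrite -EFinB sub0r opprK.
- by move=> t _; rewrite sumr_ge0// => i _; rewrite sumr_ge0// => j _; exact: sqr_ge0.
- exact: continuous_subspaceT.
- by rewrite -oppr0; exact: cvgN.
- by move=> t _; apply: ex_derive.
- apply: cvg_at_right_filter; apply: cvgN; exact: continuous_storage.
- move=> t _; rewrite derive1E derive_val; exact: opprK.
Qed.

(** By the isometry property of white noise, the power at time t is the integral
    of the squared impulse response over the elapsed time [0, t], that is
    V 0 - V t. *)
Lemma expected_power_energy : expected_power S (V 0).
Proof.
move=> d T P w ww.
suff E t : 0 < t ->
    ('E_P[fun x : T => (\sum_(i < p) (response S w t i x) ^+ 2)%R])%E =
    (V 0 - V t)%:E.
  apply: (@cvg_trans _ ((V 0 - V t)%:E @[t --> +oo])).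
    apply: near_eq_cvg; apply: filterS (nbhs_pinfty_gt (num_real (0 : R))) => t t0.
    by rewrite E.
  apply: cvg_EFin; first exact: nearW.
  rewrite -[X in _ --> X]subr0; apply: cvgB => //; exact: cvg_cst.
move=> t0.
pose f i j s := \1_(`[0, t]%classic : set R) s * h i j (t - s).
have ch i j : continuous (fun s => h i j (t - s) ^+ 2).
  move=> s; apply: cvgM; (apply: (@continuous_comp _ _ _ (fun s => t - s));
    [by apply: cvgB; [exact: cvg_cst|exact: cvg_id]|exact: continuous_impulse_response]).
have f2 i j : (fun s => (f i j s ^+ 2)%:E) =
    (fun s => (h i j (t - s) ^+ 2)%:E) \_ `[0, t]%classic.
  apply/funext => s; rewrite patchE /f indicE.
  by case: ifPn => _; rewrite ?mul1r// mul0r expr0n.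
have ih i j : (@lebesgue_measure R).-integrable `[0, t]%classic
    (fun s => (h i j (t - s) ^+ 2)%:E).
  apply: (@continuous_compact_integrable R (fun s => h i j (t - s) ^+ 2)).
    exact: segment_compact.
  exact: continuous_subspaceT.
have sf i j : square_integrable (f i j).
  split.
    apply: measurable_funM; first exact: measurable_indic.
    apply: continuous_measurable_fun => s.
    apply: (@continuous_comp _ _ _ (fun s => t - s)).
      by apply: cvgB; [exact: cvg_cst|exact: cvg_id].
    exact: continuous_impulse_response.
  by rewrite f2; apply: (iffLR (integrable_mkcond _ _) (ih i j)).
have intf i j : (\int[@lebesgue_measure R]_s (f i j s * f i j s)%:E =
    \int[@lebesgue_measure R]_(s in `[0%R, t]) (h i j (t - s) ^+ 2)%:E)%E.
  rewrite [RHS]integral_mkcond -f2.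
  by apply: eq_integral => s _; rewrite expr2.
pose v i j := fine (\int[@lebesgue_measure R]_(s in `[0%R, t]) (h i j (t - s) ^+ 2)%:E)%E.
have vE i j : (v i j)%:E = (\int[@lebesgue_measure R]_(s in `[0%R, t]) (h i j (t - s) ^+ 2)%:E)%E.
  by rewrite fineK//; apply: integrable_fin_num.
apply: etrans (@second_moment_uncorrelated _ _ _ _ _ _ (fun i j => w j (f i j)) v _) _.
  by move=> i j j'; rewrite ww//; case: eqVneq => // <-; rewrite intf vE.
transitivity (\sum_(i < p) \sum_(j < m)
    \int[@lebesgue_measure R]_(s in `[0%R, t]) (h i j (t - s) ^+ 2)%:E)%E.
  rewrite -sumEFin; apply: eq_bigr => i _; rewrite -sumEFin.
  by apply: eq_bigr => j _; exact: vE.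
under eq_bigr do rewrite -integral_sum//.
rewrite -integral_sum//; last by move=> i; exact: integrable_sum.
transitivity (\int[@lebesgue_measure R]_(s in `[0%R, t]) (H (t - s))%:E)%E.
  apply: eq_integral => s _; rewrite /H -sumEFin; apply: eq_bigr => i _.
  by rewrite -sumEFin.
have dVt s : is_derive s (1 : R) (fun s => V (t - s)) (H (t - s)).
  have d1 : is_derive s (1 : R) (fun s => t - s) (0 - 1).
    exact: (is_deriveB (is_derive_cst t s 1) (is_derive_id s 1)).
  have d2 := dV (t - s).
  have := @is_derive1_comp R V (fun s => t - s) s _ _ d2 d1.
  by congr is_derive; rewrite /GRing.scale /= sub0r mulrN1 opprK.
have cV : continuous (fun s => V (t - s)).
  by move=> s; apply/differentiable_continuous/derivable1_diffP; exact: ex_derive.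
rewrite (@continuous_FTC2 R (fun s => H (t - s)) (fun s => V (t - s)) 0 t t0).
- by rewrite subrr subr0.
- apply: continuous_subspaceT => s; apply: (@continuous_comp _ _ _ (fun s => t - s)).
    by apply: cvgB; [exact: cvg_cst|exact: cvg_id].
  exact: continuous_energy.
- split.
  + by move=> s _; apply: ex_derive.
  + by apply: cvg_at_right_filter; exact: cV.
  + by apply: cvg_at_left_filter; exact: cV.
- by move=> s _; rewrite derive1E derive_val.
Qed.

End energy.

(** * Eigenmodes of a connected weighted graph *)

Lemma char_poly_conj (R : comUnitRingType) n (P Q A : 'M[R]_n) :
  P *m Q = 1%:M -> char_poly (P *m A *m Q) = char_poly A.
Proof.
move=> PQ; rewrite /char_poly.
have -> : char_poly_mx (P *m A *m Q) =
    map_mx polyC P *m char_poly_mx A *m map_mx polyC Q.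
  rewrite /char_poly_mx mulmxBr mulmxBl -!map_mxM; congr (_ - _).
  by rewrite mul_mx_scalar -scalemxAl -map_mxM PQ map_mx1 scalemx1.
rewrite !det_mulmx mulrAC -det_mulmx -map_mxM PQ map_mx1 det1; exact: mul1r.
Qed.

(** The first listed root of the characteristic polynomial is an eigenvalue. A
    Householder reflection moves one of its unit eigenvectors to the first axis;
    by symmetry this splits off the eigenvalue as a diagonal block, and leaves
    a smaller symmetric matrix whose characteristic polynomial is the product
    over the rest of the list. Working along the list makes the i-th row of U an eigenvector of s`_i, so
    that a prescribed order of the eigenvalues is kept. *)
Lemma symmetric_spectral (R : rcfType) n (A : 'M[R]_n) (s : seq R) :
  A^T = A -> char_poly A = \prod_(x <- s) ('X - x%:P) ->
  exists2 U : 'M[R]_n, U *m U^T = 1%:M & U *m A *m U^T = diag_mx (\row_i s`_i).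
Proof.
elim: n A s => [|n IH] A s sA cA.
  by exists 1%:M; rewrite ?trmx1 ?mulmx1 //; apply/matrixP => -[].
have ss : size s = n.+1.
  have := size_char_poly A; rewrite cA size_prod_XsubC; by case.
case: s ss cA => // x s [ss] cA.
have /eigenvalueP[v vA v0] : eigenvalue A x.
  by rewrite eigenvalue_root_char cA big_cons rootM root_XsubC eqxx.
have row_sq (w : 'rV[R]_n.+1) : w *m w^T = (\sum_i w 0 i ^+ 2)%:M.
  apply/matrixP => i j; rewrite !ord1 mxE [RHS]mxE eqxx mulr1n.
  by apply: eq_bigr => k _; rewrite mxE expr2.
set vv := \sum_i v 0 i ^+ 2 in row_sq *.
have vv0 : 0 < vv.
  rewrite lt_def sumr_ge0 ?andbT; last by move=> i _; exact: sqr_ge0.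
  apply: contra_neq v0 => /eqP; rewrite psumr_eq0; last by move=> i _; exact: sqr_ge0.
  move=> /allP h; apply/rowP => i; rewrite mxE.
  by have := h i (mem_index_enum _); rewrite sqrf_eq0 => /eqP.
pose u := (Num.sqrt vv)^-1 *: v.
have uu : u *m u^T = 1%:M.
  rewrite /u linearZ /= -scalemxAl -scalemxAr scalerA row_sq -/vv.
  rewrite scale_scalar_mx; congr (_%:M).
  by rewrite -invfM -expr2 sqr_sqrtr ?(ltW vv0)// mulVf ?gt_eqF.
have uA : u *m A = x *: u by rewrite -scalemxAl vA !scalerA mulrC.
pose e : 'rV[R]_n.+1 := delta_mx 0 0.
have ee : e *m e^T = 1%:M.
  rewrite row_sq; congr (_%:M).
  by rewrite (bigD1 0)//= big1 ?mxE ?eqxx ?expr1n ?addr0// =>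
    i i0; rewrite mxE eqxx (negbTE i0) expr0n.
pose w := u - e.
pose ww := \sum_i w 0 i ^+ 2.
(* If u = e then ww = 0 and c = 0, and H below is the identity. *)
pose c := 2 / ww.
have wwE : w *m w^T = ww%:M by exact: row_sq.
pose H : 'M[R]_n.+1 := 1%:M - c *: (w^T *m w).
have HT : H^T = H.
  by rewrite /H linearB /= linearZ /= trmx1 trmx_mul trmxK.
have ww0 : (ww == 0) = (w == 0).
  rewrite psumr_eq0; last by move=> i _; exact: sqr_ge0.
  apply/allP/eqP => [h|-> i _]; last by rewrite /= mxE expr0n eqxx.
  apply/rowP => i; rewrite [RHS]mxE; have := h i (mem_index_enum _).
  by rewrite /= sqrf_eq0 => /eqP.
have [t eu] : exists t, e *m u^T = t%:M by eexists; exact: mx11_scalar.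
have ue : u *m e^T = t%:M by rewrite -[LHS]trmxK trmx_mul trmxK eu tr_scalar_mx.
have wwt : ww = 2 - 2 * t.
  have : w *m w^T = (2 - 2 * t)%:M.
    rewrite /w linearB /= mulmxBr !mulmxBl uu eu ue ee -!raddfB /=.
    by congr (_%:M); ring.
  by rewrite wwE => /matrixP/(_ 0 0); rewrite !mxE eqxx !mulr1n.
have HH : H *m H^T = 1%:M.
  pose M := w^T *m w.
  have MM : M *m M = ww *: M.
    by rewrite /M mulmxA -(mulmxA w^T w) wwE mul_mx_scalar -scalemxAl.
  rewrite HT /H -/M mulmxBr mulmx1 mulmxBl mul1mx -scalemxAl -scalemxAr MM.
  have cc : c * (c * ww) = 2 * c.
    have [ww00|wwn] := eqVneq ww 0; first by rewrite /c ww00 invr0 !mulr0.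
    by rewrite {2}/c divfK// mulrC.
  rewrite !scalerA -mulrA cc mulr_natl mulr2n scalerDl.
  by apply/matrixP => i j; rewrite !mxE; ring.
have eH : e *m H = u.
  have ew : e *m w^T = (t - 1)%:M by rewrite linearB /= mulmxBr eu ee -raddfB.
  rewrite /H mulmxBr mulmx1 -scalemxAr mulmxA ew mul_scalar_mx scalerA.
  have [ww00|wwn] := eqVneq ww 0.
    move: ww0; rewrite ww00 eqxx => /esym/eqP w0.
    by rewrite w0 scaler0 subr0; apply/eqP; rewrite eq_sym -subr_eq0 -/w w0.
  suff -> : c * (t - 1) = -1 by rewrite scaleN1r opprK addrC subrK.
  have -> : t - 1 = - ww / 2 by rewrite wwt; field.
  by rewrite /c; field.
have [B BE] : exists B : 'M[R]_(1 + n), B = H *m A *m H^T by eexists.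
have BT : B^T = B by rewrite BE !trmx_mul trmxK sA mulmxA.
have eB : e *m B = x *: e.
  by rewrite BE !mulmxA eH uA -scalemxAl -eH -mulmxA HH mulmx1.
have B0 j : B 0 j = x * (j == 0)%:R.
  have := congr1 (fun M : 'rV_n.+1 => M 0 j) eB.
  by rewrite -rowE !mxE eqxx andTb.
pose A' := drsubmx B.
have Bblk : B = block_mx x%:M 0 0 A'.
  rewrite -[LHS]submxK; congr block_mx.
  - by apply/matrixP => i j; rewrite !ord1 !mxE lshift0 B0 eqxx mulr1 mulr1n.
  - by apply/matrixP => i j; rewrite !ord1 !mxE lshift0 B0 mulr0.
  - by apply/matrixP => i j; rewrite !ord1 !mxE lshift0 -BT mxE B0 mulr0.
have A'T : A'^T = A' by rewrite /A' trmx_drsub BT.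
have cA' : char_poly A' = \prod_(y <- s) ('X - y%:P).
  have : @char_poly R (1 + n) B = char_poly A by rewrite BE; exact: char_poly_conj.
  rewrite Bblk cA big_cons.
  rewrite /char_poly char_block_diag_mx det_ublock.
  rewrite {1}/char_poly_mx map_scalar_mx -raddfB /= det_scalar1.
  by apply: mulfI; rewrite polyXsubC_eq0.
have [U' UU' UA'] := IH A' s A'T cA'.
pose D : 'M[R]_(1 + n) := block_mx 1%:M 0 0 U'.
have DT : D^T = block_mx 1%:M 0 0 U'^T by rewrite tr_block_mx trmx1 !trmx0.
have DD : D *m D^T = 1%:M.
  rewrite DT mulmx_block !mulmx0 !mul0mx !mulmx1 !addr0 !add0r UU'.
  by rewrite -scalar_mx_block.
have DBD : D *m B *m D^T = block_mx x%:M 0 0 (diag_mx (\row_i s`_i)).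
  rewrite DT Bblk !mulmx_block.
  by rewrite !mulmx0 !mul0mx !mulmx1 !mul1mx !addr0 !add0r UA' mul0mx.
exists (D *m H); first by rewrite trmx_mul mulmxA -(mulmxA D) HH mulmx1.
have -> : D *m H *m A *m (D *m H)^T = D *m B *m D^T.
  by rewrite BE trmx_mul !mulmxA.
rewrite DBD; apply/(@matrixP R (1 + n) (1 + n)) => i j.
rewrite -(fintype.splitK i) -(fintype.splitK j).
case: (fintype.split i) => i'; case: (fintype.split j) => j' /=.
- by rewrite block_mxEul !ord1 !mxE !eqxx.
- rewrite block_mxEur !mxE (_ : (_ == _) = false)//; exact: eq_lrshift.
- rewrite block_mxEdl !mxE (_ : (_ == _) = false)//.
  by apply/eqP => /(congr1 val) /=; rewrite ord1.
- rewrite block_mxEdr !mxE [X in _ = _ *+ nat_of_bool X](_ : _ = (i' == j'))//.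
Qed.

(** Symmetrizing the double sum of W i j * x_j (x_j - x_i) in i and j. *)
Lemma laplacian_form (R : realType) n (W : 'M[R]_n) (x : 'rV[R]_n) : W^T = W ->
  (x *m laplacian W *m x^T) 0 0 =
  2^-1 * \sum_i \sum_j W i j * (x 0 i - x 0 j) ^+ 2.
Proof.
move=> sW; have Wji i j : W j i = W i j by rewrite -[in LHS]sW mxE.
have -> : (x *m laplacian W *m x^T) 0 0 = \sum_i \sum_j W i j * (x 0 j * (x 0 j - x 0 i)).
  rewrite mxE exchange_big; apply: eq_bigr => i _ /=; rewrite !mxE.
  rewrite [RHS](bigD1 i)//= subrr !mulr0 add0r (bigD1 i)//= mxE eqxx.
  rewrite mulrDl mulr_sumr !mulr_suml -big_split /=; apply: eq_bigr => j ji.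
  by rewrite mxE (negbTE ji) (Wji i j); ring.
set s := LHS; suff <- : s + s = \sum_i \sum_j W i j * (x 0 i - x 0 j) ^+ 2 by field.
rewrite {1}/s exchange_big -big_split; apply: eq_bigr => i _ /=.
rewrite -big_split /=; apply: eq_bigr => j _ /=.
by rewrite (Wji i j); ring.
Qed.

Lemma edge_weights_ge0 (R : realType) n (E : rel 'I_n) (W : 'M[R]_n) i j :
  edge_weights E W -> 0 <= W i j.
Proof.
by case=> _ Wpos Wzero; case: (boolP (E i j)) => [/Wpos/ltW//|/Wzero ->].
Qed.

(** All terms W i j (x_i - x_j)^2 of the quadratic form vanish, so x is constant
    along edges, hence along paths. *)
Lemma laplacian_kernel (R : realType) n (E : rel 'I_n) (W : 'M[R]_n) (x : 'rV[R]_n) :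
  connected_graph E -> edge_weights E W -> (x *m laplacian W *m x^T) 0 0 = 0 ->
  forall i j, x 0 i = x 0 j.
Proof.
move=> cE wE; have [sW Wpos _] := wE; rewrite laplacian_form// => /eqP.
rewrite mulf_eq0 invr_eq0 pnatr_eq0 /=.
have W0 i j := edge_weights_ge0 i j wE.
rewrite psumr_eq0; last first.
  by move=> i _; rewrite sumr_ge0// => j _; rewrite mulr_ge0 ?sqr_ge0.
move=> /allP h.
have xE i j : E i j -> x 0 i = x 0 j.
  move=> Eij; have /= := h i (mem_index_enum _).
  rewrite psumr_eq0 => [/allP/(_ j (mem_index_enum _))/=|k _]; last first.
    by rewrite mulr_ge0 ?sqr_ge0.
  by rewrite mulf_eq0 gt_eqF ?Wpos//= sqrf_eq0 subr_eq0 => /eqP.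
move=> i j; have /connectP[s sp ->] := cE i j.
by elim: s i sp => //= k s IH i /andP[/xE -> /IH].
Qed.

(** An orthonormal eigenbasis of the Laplacian of a connected graph, in the order
    of the given spectrum; row i belongs to the eigenvalue number i.+1. The
    constant vector forces an eigenvalue 0; two null eigenvectors would both be
    constant, hence not orthogonal. All other rows are orthogonal to the
    constant vector, which hides them from a controller that only sees and
    moves the average. *)
Lemma laplacian_modes (R : realType) n (E : rel 'I_n) (W : 'M[R]_n)
    (lambda : nat -> R) :
  (2 <= n)%N -> connected_graph E -> edge_weights E W ->
  ordered_spectrum (laplacian W) lambda ->
  [/\ lambda 1%N = 0, forall i, (2 <= i <= n)%N -> 0 < lambda i &
  exists U : 'M[R]_n, [/\ U *m U^T = 1%:M,
    U *m laplacian W = diag_mx (\row_i lambda i.+1) *m U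
    & forall i : 'I_n, (0 < i)%N -> row i U *m const_mx 1 = 0 :> 'rV_1]].
Proof.
move=> n2 cE wE [cL le]; have [sW _ _] := wE.
set L := laplacian W in cL *.
have W0 i j := edge_weights_ge0 i j wE.
have sL : L^T = L.
  apply/matrixP => i j; rewrite !mxE eq_sym; case: eqVneq => [->//|_].
  by rewrite -[in LHS]sW mxE.
have L1 : L *m (const_mx 1 : 'cV_n) = 0.
  apply/matrixP => i j; rewrite !mxE (bigD1 i)//= !mxE eqxx mulr1 -big_split /=.
  by apply: big1 => k ki; rewrite !mxE eq_sym (negbTE ki) mulr1 subrr.
have [U UU] : exists2 U : 'M[R]_n, U *m U^T = 1%:M &
    U *m L *m U^T = diag_mx (\row_i [seq lambda k | k <- iota 1 n]`_i).
  apply: symmetric_spectral => //.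
  by rewrite cL big_map /index_iota subn1.
have -> : (\row_i [seq lambda k | k <- iota 1 n]`_i) = (\row_(i < n) lambda i.+1).
  by apply/rowP => i; rewrite !mxE (nth_map 0%N) ?size_iota// nth_iota.
move=> UL.
have UtU : U^T *m U = 1%:M by exact: mulmx1C.
have ULd : U *m L = diag_mx (\row_i lambda i.+1) *m U.
  by rewrite -UL -mulmxA UtU mulmx1.
have uLu (i : 'I_n) : (row i U *m L *m (row i U)^T) 0 0 = lambda i.+1.
  have <- : (U *m L *m U^T) i i = lambda i.+1 by rewrite UL !mxE eqxx mulr1n.
  by rewrite !mxE; apply: eq_bigr => k _; rewrite -row_mul !mxE.
have l0 (i : 'I_n) : 0 <= lambda i.+1.
  rewrite -uLu laplacian_form// mulr_ge0// sumr_ge0// => a _.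
  by rewrite sumr_ge0// => b _; rewrite mulr_ge0 ?sqr_ge0.
have lU1 (i : 'I_n) : lambda i.+1 * (U *m (const_mx 1 : 'cV_n)) i 0 = 0.
  have : diag_mx (\row_i lambda i.+1) *m U *m (const_mx 1 : 'cV_n) = 0.
    by rewrite -ULd -mulmxA L1 mulmx0.
  rewrite -mulmxA mul_diag_mx => /matrixP/(_ i 0).
  by rewrite mxE [X in X * _]mxE [in RHS]mxE.
pose i0 : 'I_n := Ordinal (ltnW n2).
pose i1 : 'I_n := Ordinal n2.
have l1 : lambda 1%N = 0.
  apply/eqP; rewrite eq_le (l0 i0) andbT leNgt; apply/negP => lpos.
  have : U *m (const_mx 1 : 'cV_n) = 0.
    apply/matrixP => i j; rewrite ord1 [RHS]mxE; apply/eqP.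
    have /eqP := lU1 i; rewrite mulf_eq0 => /orP[/eqP h|//].
    by move: (le 1%N i.+1 isT isT (ltn_ord i)); rewrite h leNgt lpos.
  move=> /(congr1 (mulmx U^T)); rewrite mulmxA UtU mul1mx mulmx0.
  by move=> /matrixP/(_ i0 0)/eqP; rewrite !mxE oner_eq0.
have l2 : 0 < lambda 2%N.
  rewrite lt_def (l0 i1) andbT; apply/eqP => l20.
  have c0 := laplacian_kernel cE wE (etrans (uLu i0) l1).
  have c1 := laplacian_kernel cE wE (etrans (uLu i1) l20).
  have dot (a b : 'I_n) : (forall i j, row a U 0 i = row a U 0 j) ->
      (forall i j, row b U 0 i = row b U 0 j) ->
      (a == b)%:R = n%:R * (U a i0 * U b i0).
    move=> ha hb; have <- : (U *m U^T) a b = (a == b)%:R by rewrite UU mxE.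
    rewrite mxE mulr_natl.
    rewrite -[X in _ *+ X]card_ord -sumr_const; apply: eq_bigr => k _.
    by have := ha k i0; have := hb k i0; rewrite !mxE => -> ->.
  have : n%:R * (U i0 i0 * U i0 i0) * (n%:R * (U i1 i0 * U i1 i0)) =
      (n%:R * (U i0 i0 * U i1 i0)) ^+ 2 by ring.
  rewrite -!dot// !eqxx (_ : i0 == i1 = false)// mulr1 expr0n /= => /eqP.
  by rewrite oner_eq0.
have lpos i : (2 <= i <= n)%N -> 0 < lambda i.
  by move=> /andP[i2 ni]; apply: lt_le_trans l2 _; exact: le.
split=> //; exists U; split=> // i ipos.
apply/matrixP => a b; rewrite !ord1 [RHS]mxE.
have /eqP := lU1 i; rewrite mulf_eq0 gt_eqF /=; last first.
  by apply: lpos; rewrite ltnS ipos ltn_ord.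
by move=> /eqP h; rewrite -row_mul mxE.
Qed.

(** * Modal decomposition of the output energy *)

Lemma is_derive_sumr (R : realType) (I : finType) (D : pred I)
    (f : I -> R -> R) (df : I -> R) (t : R) :
  (forall i, D i -> is_derive t (1 : R) (f i) (df i)) ->
  is_derive t (1 : R) (fun s => \sum_(i | D i) f i s) (\sum_(i | D i) df i).
Proof.
move=> fdf; have -> : (fun s => \sum_(i | D i) f i s) = \sum_(i | D i) f i.
  by apply/funext => s; rewrite fct_sumE.
elim/big_ind2 : _ => // [|g dg h dh ? ?]; first exact: is_derive_cst.
exact: is_deriveD.
Qed.

(** The squared Frobenius norm of C X depends on C only through C^T C. *)
Lemma sum_sqr_gram (R : realType) (I : finType) (D : pred I) N m p
    (C : 'M[R]_(p, N)) (X : 'M[R]_(N, m)) (beta : I -> R) (P : I -> 'rV[R]_N) :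
  C^T *m C = \sum_(i | D i) beta i *: ((P i)^T *m P i) ->
  \sum_(a < p) \sum_(j < m) (C *m X) a j ^+ 2 =
  \sum_(i | D i) beta i * \sum_(j < m) (P i *m X) 0 j ^+ 2.
Proof.
move=> CC; rewrite exchange_big /=.
under [RHS]eq_bigr do rewrite mulr_sumr.
rewrite [RHS]exchange_big /=; apply: eq_bigr => j _.
have -> : \sum_(a < p) (C *m X) a j ^+ 2 = (X^T *m (C^T *m C) *m X) j j.
  rewrite mulmxA -trmx_mul -mulmxA mxE; apply: eq_bigr => a _.
  by rewrite [in RHS]mxE expr2.
rewrite CC mulmx_sumr mulmx_suml summxE; apply: eq_bigr => i _.
rewrite -scalemxAr -scalemxAl mxE; congr (_ * _).
rewrite mulmxA -trmx_mul -mulmxA mxE big_ord1.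
by rewrite [X in X * _]mxE expr2.
Qed.

(** The rows p1 i, p2 i, p3 i are modal coordinates of the state: multiplying the
    state equation by them on the left turns it into the scalar equations of a
    coupled mode, and the output energy is a weighted sum of the p1 coordinates
    squared. Only the modes in D are seen by the output. *)
Section modal.
Variables (R : realType) (I : finType) (D : pred I) (N m p : nat).
Variables (S : lti R N m p) (tau q s : R) (kap c beta : I -> R).
Variables p1 p2 p3 : I -> 'rV[R]_N.
Hypotheses (tau0 : 0 < tau) (q0 : 0 < q) (s1 : s ^+ 2 <= 1).
Hypothesis kap0 : forall i, D i -> 0 < kap i.
Hypothesis c0 : forall i, D i -> 0 < c i.
Hypothesis p1A : forall i, D i -> p1 i *m stA S = p2 i.
Hypothesis p2A : forall i, D i ->
  p2 i *m stA S = tau^-1 *: (- kap i *: p1 i - p2 i + s *: p3 i).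
Hypothesis p3A : forall i, D i ->
  p3 i *m stA S = q^-1 *: (- s *: p2 i - c i *: p3 i).
Hypothesis p1B : forall i, D i -> p1 i *m inB S = 0.
Hypothesis outS :
  (outC S)^T *m outC S = \sum_(i | D i) beta i *: ((p1 i)^T *m p1 i).

Definition modal_loss : R := \sum_(i | D i) beta i *
  \sum_(j < m) mode_loss (kap i) tau q (c i) s
    ((p2 i *m inB S) 0 j) ((p3 i *m inB S) 0 j).

Let mode (P : 'rV[R]_N) j t := (P *m expmx (t *: stA S) *m inB S) 0 j.

Let mode0 P j : mode P j 0 = (P *m inB S) 0 j.
Proof. by rewrite /mode expmx0 mulmx1. Qed.

(** The storage functions of the modes add up, with the weights of the output. *)
Lemma modal_storage : exists V : R -> R,
  [/\ forall t, is_derive t (1 : R) V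
        (- \sum_(a < p) \sum_(j < m) impulse_response S t a j ^+ 2),
      V t @[t --> +oo] --> (0 : R) & V 0 = modal_loss].
Proof.
have VV (ij : I * 'I_m) : exists V : R -> R, D ij.1 ->
    [/\ forall t, is_derive t (1 : R) V (- mode (p1 ij.1) ij.2 t ^+ 2),
        V t @[t --> +oo] --> (0 : R) & V 0 = mode_loss (kap ij.1) tau q (c ij.1) s
          ((p2 ij.1 *m inB S) 0 ij.2) ((p3 ij.1 *m inB S) 0 ij.2)].
  case: ij => i j /=; have [Di|/negP nDi] := boolP (D i); last by exists id.
  have dm (P : 'rV[R]_N) t := is_derive_mul_expmx P (stA S) (inB S) 0 j t.
  have d1 t : is_derive t (1 : R) (mode (p1 i) j) (mode (p2 i) j t).
    by have := dm (p1 i) t; rewrite p1A.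
  have d2 t : is_derive t (1 : R) (mode (p2 i) j)
     ((- kap i * mode (p1 i) j t - mode (p2 i) j t + s * mode (p3 i) j t) / tau).
    have := dm (p2 i) t; rewrite p2A//; congr is_derive.
    rewrite /mode -!scalemxAl mxE mulrC; congr (_ / _).
    by rewrite !mulmxDl !mulNmx -!scalemxAl !mxE.
  have d3 t : is_derive t (1 : R) (mode (p3 i) j)
     ((- s * mode (p2 i) j t - c i * mode (p3 i) j t) / q).
    have := dm (p3 i) t; rewrite p3A//; congr is_derive.
    rewrite /mode -!scalemxAl mxE mulrC; congr (_ / _).
    by rewrite !mulmxDl !mulNmx -!scalemxAl !mxE.
  have m0 : mode (p1 i) j 0 = 0 by rewrite mode0 p1B// mxE.
  have [V [dV Vl V0]] := coupled_mode_energy (kap0 Di) tau0 q0 (c0 Di) s1 d1 d2 d3 m0.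
  by exists V => _; split=> //; rewrite V0 !mode0.
have /choice[V HV] := VV.
exists (fun t => \sum_(i | D i) beta i * \sum_(j < m) V (i, j) t); split.
- move=> t; rewrite /impulse_response.
  under eq_bigr do under eq_bigr do rewrite -mulmxA.
  rewrite (sum_sqr_gram _ outS) -sumrN; apply: is_derive_sumr => i Di.
  rewrite -mulrN -sumrN.
  have dS : is_derive t (1 : R) (fun t => \sum_(j < m) V (i, j) t)
      (\sum_(j < m) - (p1 i *m (expmx (t *: stA S) *m inB S)) 0 j ^+ 2).
    apply: is_derive_sumr => j _; have [h _ _] := HV (i, j) Di.
    by have := h t; rewrite /mode /= mulmxA.
  exact: (is_deriveZ (beta i) dS).
- rewrite [X in _ --> X](_ : 0 = \sum_(i | D i) beta i * \sum_(j < m) (0 : R)); last first.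
    by rewrite big1// => i _; rewrite big1 ?mulr0.
  apply: (@cvg_sumr R R) => i Di; apply: cvgMl_tmp; apply: (@cvg_sumr R R) => j _.
  by have [] := HV (i, j) Di.
- rewrite /modal_loss; apply: eq_bigr => i Di; congr (_ * _); apply: eq_bigr => j _.
  by have [] := HV (i, j) Di.
Qed.

Lemma modal_h2 : sq_h2norm S = modal_loss%:E /\ expected_power S modal_loss.
Proof.
have [V [dV Vl <-]] := modal_storage.
by split; [exact: sq_h2norm_energy|exact: expected_power_energy].
Qed.

End modal.

(** * The two controllers *)

Lemma mul_row3_block3 (R : pzRingType) m m1 m2 m3 n1 n2 n3
    (a : 'M[R]_(m, m1)) (b : 'M[R]_(m, m2)) (c : 'M[R]_(m, m3))
    (A11 : 'M[R]_(m1, n1)) (A12 : 'M[R]_(m1, n2)) (A13 : 'M[R]_(m1, n3))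
    (A21 : 'M[R]_(m2, n1)) (A22 : 'M[R]_(m2, n2)) (A23 : 'M[R]_(m2, n3))
    (A31 : 'M[R]_(m3, n1)) (A32 : 'M[R]_(m3, n2)) (A33 : 'M[R]_(m3, n3)) :
  row_mx a (row_mx b c) *m block_mx3 A11 A12 A13 A21 A22 A23 A31 A32 A33 =
  row_mx (a *m A11 + (b *m A21 + c *m A31))
    (row_mx (a *m A12 + (b *m A22 + c *m A32))
            (a *m A13 + (b *m A23 + c *m A33))).
Proof. by rewrite /block_mx3 !mul_row_col !mul_mx_row !add_row_mx. Qed.

Section block_diagonal.
Variables (R : fieldType) (n1 n2 n3 : nat) (d1 d2 d3 : R).
Hypotheses (d1n0 : d1 != 0) (d2n0 : d2 != 0) (d3n0 : d3 != 0).
Let M : 'M[R]_(n1 + (n2 + n3)) :=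
  block_mx3 d1%:M 0 0 0 d2%:M 0 0 0 d3%:M.

Lemma block_diag3_unit : M \in unitmx.
Proof.
suff h : M *m block_mx3 d1^-1%:M 0 0 0 d2^-1%:M 0 0 0 d3^-1%:M = 1%:M.
  by have [] := mulmx1_unit h.
rewrite {1}/M {1}/block_mx3 !mul_col_mx !mul_row3_block3 !mulmx0 !mul0mx !addr0 !add0r.
rewrite -!scalar_mxM !mulfV//.
rewrite [in RHS]scalar_mx_block (scalar_mx_block n2 n3) /block_mx !row_mx0.
by rewrite -[X in row_mx X (col_mx _ _)]col_mx0 -block_mxEh.
Qed.

Lemma mul_row3_invmx (m : nat) (a : 'M[R]_(m, n1)) (b : 'M[R]_(m, n2))
    (c : 'M[R]_(m, n3)) :
  row_mx a (row_mx b c) *m invmx M =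
  row_mx (d1^-1 *: a) (row_mx (d2^-1 *: b) (d3^-1 *: c)).
Proof.
rewrite -[RHS](mulmxK block_diag3_unit); congr (_ *m _).
rewrite mul_row3_block3 !mulmx0 !addr0 !add0r !mul_mx_scalar !scalerA.
by rewrite !mulfV// !scale1r.
Qed.
End block_diagonal.

(** The output energy theta^T (alpha L) theta in the eigenbasis of L. The first
    mode drops out because its eigenvalue is 0; this is why the marginally
    stable average angle does not spoil the finiteness of the norm. *)
Lemma output_modes (R : realType) n n2 n3 (L H U : 'M[R]_n) (alpha : R)
    (lambda : nat -> R) (J := row_mx 1%:M (row_mx 0 0) : 'M[R]_(n, n + (n2 + n3))) :
  possemidef H -> H *m H = alpha *: L -> U *m U^T = 1%:M ->
  U *m L = diag_mx (\row_i lambda i.+1) *m U -> lambda 1%N = 0 ->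
  (row_mx H (row_mx 0 0))^T *m row_mx H (row_mx 0 0) =
  \sum_(i < n | (0 < i)%N) (alpha * lambda i.+1) *:
     ((row_mx (row i U) (row_mx 0 0))^T *m row_mx (row i U) (row_mx 0 0))
   :> 'M[R]_(n + (n2 + n3)).
Proof.
move=> [sH _] HH UU UL l1.
have rJ m (u : 'M[R]_(m, n)) : row_mx u (row_mx 0 0) = u *m J.
  by rewrite /J !mul_mx_row mulmx1 !mulmx0.
rewrite rJ trmx_mul sH mulmxA -(mulmxA _ H H) HH.
have -> : L = \sum_(i < n) lambda i.+1 *: ((row i U)^T *m row i U).
  rewrite -[LHS]mul1mx -(mulmx1C UU) -mulmxA UL.
  apply/matrixP => a b; rewrite mxE summxE; apply: eq_bigr => i _.
  rewrite mul_diag_mx !mxE big_ord1 !mxE; ring.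
rewrite [RHS](eq_bigr (fun i : 'I_n => J^T *m ((alpha * lambda i.+1) *:
    ((row i U)^T *m row i U)) *m J)); last first.
  by move=> i _; rewrite rJ trmx_mul -scalemxAr -scalemxAl !mulmxA.
rewrite -mulmx_suml -mulmx_sumr; congr (_ *m _ *m _).
rewrite scaler_sumr [LHS](bigID (fun i : 'I_n => 0 < i)%N) /=.
rewrite [X in _ + X]big1 ?addr0.
  by apply: eq_bigr => i _; rewrite scalerA.
by move=> i; rewrite lt0n negbK => /eqP ->; rewrite l1 scale0r scaler0.
Qed.

(** The loss of a mode is quadratic in its initial state, so that unit impulses
    in all nodes, weighted by a unit eigenvector, contribute as one impulse. *)
Lemma sum_mode_loss (R : realType) m (kap tau q c s a b : R) (u : 'rV[R]_m) :
  u *m u^T = 1%:M ->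
  \sum_(j < m) mode_loss kap tau q c s (a * u 0 j) (b * u 0 j) =
  mode_loss kap tau q c s a b.
Proof.
move=> uu; have u1 : \sum_(j < m) u 0 j ^+ 2 = 1.
  transitivity ((u *m u^T) 0 0); last by rewrite uu mxE.
  by rewrite mxE; apply: eq_bigr => j _; rewrite mxE expr2.
rewrite -[RHS]mulr1 -u1 mulr_sumr; apply: eq_bigr => j _.
by rewrite /mode_loss [RHS]mulrAC; congr (_ / _); ring.
Qed.

Lemma big_nat_modes (R : realType) n (F : nat -> R) :
  \sum_(2 <= i < n.+1) F i = \sum_(i < n | (0 < i)%N) F i.+1.
Proof. by rewrite big_add1 big_geq_mkord. Qed.

Lemma row_orthonormal (R : realType) n (U : 'M[R]_n) (i : 'I_n) :
  U *m U^T = 1%:M -> row i U *m (row i U)^T = 1%:M.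
Proof.
move=> UU; apply/matrixP => a b; rewrite !ord1.
rewrite [RHS]mxE eqxx mulr1n.
have <- : (U *m U^T) i i = 1 by rewrite UU mxE eqxx.
by rewrite [LHS]mxE [RHS]mxE; apply: eq_bigr => j _; rewrite !mxE.
Qed.

Lemma mode_loss_power (R : realType) (l gamma k q tau alpha : R) :
  0 < l -> 0 < gamma -> 0 < k -> 0 < q -> 0 < tau ->
  alpha * l * mode_loss (k * l) tau q (gamma * l) 1 tau^-1 0 =
  alpha / (2 * k) * (1 / (1 + (phi l gamma k q tau)^-1)).
Proof.
move=> l0 g0 k0 q0 t0; rewrite /mode_loss /phi.
have p1 : 0 < q + tau * gamma * l by rewrite !addr_gt0 ?mulr_gt0.
have p2 : 0 < k * q ^+ 2 * l + q * gamma * l + tau * (gamma * l) ^+ 2.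
  by rewrite !addr_gt0 ?mulr_gt0 ?exprn_gt0 ?mulr_gt0.
have p3 := addr_gt0 p2 p1.
field.
by rewrite !gt_eqF.
Qed.

Lemma mode_loss_measurement (R : realType) (l gamma k q tau alpha eps : R) :
  0 < l -> 0 < gamma -> 0 < k -> 0 < q -> 0 < tau ->
  alpha * l * mode_loss (k * l) tau q (gamma * l) 1 0 (q^-1 * eps) =
  eps ^+ 2 * (alpha / (2 * k)) *
    (1 / (gamma * l) * (1 / (1 + phi l gamma k q tau))).
Proof.
move=> l0 g0 k0 q0 t0; rewrite /mode_loss /phi.
have p1 : 0 < q + tau * gamma * l by rewrite !addr_gt0 ?mulr_gt0.
have p2 : 0 < k * q ^+ 2 * l + q * gamma * l + tau * (gamma * l) ^+ 2.
  by rewrite !addr_gt0 ?mulr_gt0 ?exprn_gt0 ?mulr_gt0.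
have p3 := addr_gt0 p2 p1.
field.
by rewrite !gt_eqF//= addrC.
Qed.

Lemma mode_loss_uncoupled (R : realType) (kap tau q c : R) :
  0 < kap -> 0 < q -> 0 < c -> 0 < tau ->
  mode_loss kap tau q c 0 tau^-1 0 = 1 / (2 * kap).
Proof.
move=> k0 q0 c0 t0; rewrite /mode_loss.
have p : 0 < q ^+ 2 * kap + c * q + tau * c ^+ 2.
  by rewrite !addr_gt0 ?mulr_gt0 ?exprn_gt0.
field.
by rewrite !gt_eqF.
Qed.

Section network.
Variables (R : realType) (n : nat) (L H U : 'M[R]_n) (lambda : nat -> R).
Variables (alpha tau q k gamma eps : R).
Hypotheses (tau0 : 0 < tau) (q0 : 0 < q) (k0 : 0 < k) (gamma0 : 0 < gamma).
Hypotheses (H0 : possemidef H) (HH : H *m H = alpha *: L).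
Hypotheses (UU : U *m U^T = 1%:M)
  (UL : U *m L = diag_mx (\row_i lambda i.+1) *m U).
Hypothesis lambda1 : lambda 1%N = 0.
Hypothesis lambda_gt0 : forall i, (2 <= i <= n)%N -> 0 < lambda i.

Let lam_gt0 (i : 'I_n) : (0 < i)%N -> 0 < lambda i.+1.
Proof. by move=> i0; apply: lambda_gt0; rewrite ltnS i0 ltn_ord. Qed.

Let row_L (i : 'I_n) : row i U *m L = lambda i.+1 *: row i U.
Proof. by rewrite -row_mul UL mul_diag_mx; apply/rowP => j; rewrite !mxE. Qed.

Let row_kL (i : 'I_n) : row i U *m (k%:M *m L) = (k * lambda i.+1) *: row i U.
Proof. by rewrite mulmxA mul_mx_scalar -scalemxAl row_L scalerA. Qed.

Let tn0 : tau != 0. Proof. by rewrite gt_eqF. Qed.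
Let qn0 : q != 0. Proof. by rewrite gt_eqF. Qed.

Section distributed.
Let SD := dapi tau%:M q%:M k%:M L (gamma *: L) H eps.

(** The input matrix is kept arbitrary, as the whole system and its two channels
    only differ there. All matrices of the distributed loop are polynomials in
    L, so that each eigenvector of L decouples a mode with stiffness k * lambda,
    integrator leak gamma * lambda and coupling 1. *)
Lemma dapi_modal m (B : 'M[R]_(n + (n + n), m)) :
  (forall i : 'I_n, (0 < i)%N -> row_mx (row i U) (row_mx 0 0) *m B = 0) ->
  let S := Lti (stA SD) B (outC SD) in
  let l := \sum_(i < n | (0 < i)%N) alpha * lambda i.+1 * \sum_(j < m)
    mode_loss (k * lambda i.+1) tau q (gamma * lambda i.+1) 1
      ((row_mx 0 (row_mx (row i U) 0) *m B) 0 j)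
      ((row_mx 0 (row_mx 0 (row i U)) *m B) 0 j) in
  sq_h2norm S = l%:E /\ expected_power S l.
Proof.
move=> p1B S; apply: (@modal_h2 R _ (fun i : 'I_n => 0 < i)%N _ _ _ S tau q 1
  (fun i => k * lambda i.+1) (fun i => gamma * lambda i.+1)
  (fun i => alpha * lambda i.+1) (fun i => row_mx (row i U) (row_mx 0 0))) => //.
- by move=> i i0; rewrite mulr_gt0 ?lam_gt0.
- by move=> i i0; rewrite mulr_gt0 ?lam_gt0.
- move=> i _; rewrite /= mulmxA mul_row3_invmx ?oner_neq0// mul_row3_block3.
  by rewrite !scaler0 !mul0mx !mulmx0 !addr0 invr1 scale1r mulmx1.
- move=> i _; rewrite /= mulmxA mul_row3_invmx ?oner_neq0// mul_row3_block3.
  rewrite !scaler0 !mul0mx !addr0 !add0r -!scalemxAl !mulmxN row_kL !mulmx1.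
  rewrite !scale_row_mx !opp_row_mx !add_row_mx !scale_row_mx.
  by rewrite !scaler0 !oppr0 !addr0 !add0r !scale1r scaleNr.
- move=> i _; rewrite /= mulmxA mul_row3_invmx ?oner_neq0// mul_row3_block3.
  rewrite !(scaler0, mul0mx, mulmx0, addr0, add0r) -!scalemxAl !mulmxN !mulmx1.
  rewrite -scalemxAr row_L.
  rewrite !scale_row_mx !opp_row_mx !add_row_mx !scale_row_mx.
  by rewrite !(scaler0, oppr0, addr0, add0r) !scaleN1r scalerA.
- exact: (output_modes _ _ H0 HH UU UL lambda1).
Qed.

Let in1 (i : 'I_n) : row_mx (row i U) (row_mx 0 0) *m inB SD = 0.
Proof.
rewrite /= mulmxA mul_row3_invmx ?oner_neq0// !mul_row_col !mul_mx_row.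
by rewrite !scaler0 !mul0mx !mulmx0 !add_row_mx !addr0 row_mx0.
Qed.

Let in2 (i : 'I_n) :
  row_mx 0 (row_mx (row i U) 0) *m inB SD = row_mx (tau^-1 *: row i U) 0.
Proof.
rewrite /= mulmxA mul_row3_invmx ?oner_neq0// !mul_row_col !mul_mx_row.
by rewrite !scaler0 !mul0mx !mulmx0 !add_row_mx !addr0 !add0r mulmx1.
Qed.

Let in3 (i : 'I_n) :
  row_mx 0 (row_mx 0 (row i U)) *m inB SD = row_mx 0 ((q^-1 * eps) *: row i U).
Proof.
rewrite /= mulmxA mul_row3_invmx ?oner_neq0// !mul_row_col !mul_mx_row.
rewrite !scaler0 !mul0mx !mulmx0 !add_row_mx !addr0 !add0r mul_mx_scalar.
by rewrite scalerA mulrC.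
Qed.

Let lossP := alpha / (2 * k) *
    \sum_(2 <= i < n.+1) 1 / (1 + (phi (lambda i) gamma k q tau)^-1).
Let lossEta := eps ^+ 2 * (alpha / (2 * k)) *
    \sum_(2 <= i < n.+1)
      1 / (gamma * lambda i) * (1 / (1 + phi (lambda i) gamma k q tau)).

Let sumP (i : 'I_n) : (0 < i)%N -> alpha * lambda i.+1 * \sum_(j < n)
   mode_loss (k * lambda i.+1) tau q (gamma * lambda i.+1) 1
     ((tau^-1 *: row i U) 0 j) ((0 : 'rV[R]_n) 0 j) =
   alpha / (2 * k) * (1 / (1 + (phi (lambda i.+1) gamma k q tau)^-1)).
Proof.
move=> i0; rewrite -(mode_loss_power _ (lam_gt0 i0))//; congr (_ * _).
rewrite -(sum_mode_loss _ _ _ _ _ _ _ (row_orthonormal i UU)).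
by apply: eq_bigr => j _; rewrite !mxE mul0r.
Qed.

Let sumEta (i : 'I_n) : (0 < i)%N -> alpha * lambda i.+1 * \sum_(j < n)
   mode_loss (k * lambda i.+1) tau q (gamma * lambda i.+1) 1
     ((0 : 'rV[R]_n) 0 j) (((q^-1 * eps) *: row i U) 0 j) =
   eps ^+ 2 * (alpha / (2 * k)) *
    (1 / (gamma * lambda i.+1) * (1 / (1 + phi (lambda i.+1) gamma k q tau))).
Proof.
move=> i0; rewrite -(mode_loss_measurement _ _ (lam_gt0 i0))//; congr (_ * _).
rewrite -(sum_mode_loss _ _ _ _ _ _ _ (row_orthonormal i UU)).
by apply: eq_bigr => j _; rewrite !mxE mul0r.
Qed.

Lemma dapi_power_loss :
  sq_h2norm (channel1 SD) = lossP%:E /\ expected_power (channel1 SD) lossP.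
Proof.
have := @dapi_modal _ (lsubmx (inB SD)); set l := \sum_(i < n | _) _ => h.
have <- : l = lossP.
  rewrite /l /lossP mulr_sumr big_nat_modes; apply: eq_bigr => i i0.
  by rewrite -sumP// !mulmx_lsub in2 in3 !row_mxKl.
by apply: h => i _; rewrite mulmx_lsub in1 linear0.
Qed.

Lemma dapi_measurement_loss :
  sq_h2norm (channel2 SD) = lossEta%:E /\ expected_power (channel2 SD) lossEta.
Proof.
have := @dapi_modal _ (rsubmx (inB SD)); set l := \sum_(i < n | _) _ => h.
have <- : l = lossEta.
  rewrite /l /lossEta mulr_sumr big_nat_modes; apply: eq_bigr => i i0.
  by rewrite -sumEta// !mulmx_rsub in2 in3 !row_mxKr.
by apply: h => i _; rewrite mulmx_rsub in1 linear0.
Qed.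

Lemma dapi_total_loss :
  sq_h2norm SD = (lossP + lossEta)%:E /\ expected_power SD (lossP + lossEta).
Proof.
have := @dapi_modal _ (inB SD); set l := \sum_(i < n | _) _ => h.
have <- : l = lossP + lossEta.
  rewrite /l /lossP /lossEta !mulr_sumr !big_nat_modes -big_split.
  apply: eq_bigr => i i0 /=; rewrite -sumP// -sumEta// -mulrDr in2 in3.
  rewrite big_split_ord /=; congr (_ * (_ + _)); apply: eq_bigr => j _.
    by rewrite !row_mxEl.
  by rewrite !row_mxEr.
by apply: h => i _; exact: in1.
Qed.
End distributed.

Section centralized.
Hypothesis rowU1 : forall i : 'I_n, (0 < i)%N ->
  row i U *m const_mx 1 = 0 :> 'rV_1.
Let SC := capi tau%:M k%:M L H q eps.

(** The averaged integrator acts along the constant vector, which is orthogonal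
    to the eigenvectors of positive eigenvalues: these modes obey the coupled
    equations with coupling 0 and third coordinate 0, for which the time
    constant and the leak of the integrator can be any positive number, here 1. *)
Lemma capi_modal m (B : 'M[R]_(n + (n + 1), m)) :
  (forall i : 'I_n, (0 < i)%N -> row_mx (row i U) (row_mx 0 0) *m B = 0) ->
  let S := Lti (stA SC) B (outC SC) in
  let l := \sum_(i < n | (0 < i)%N) alpha * lambda i.+1 * \sum_(j < m)
    mode_loss (k * lambda i.+1) tau 1 1 0
      ((row_mx 0 (row_mx (row i U) 0) *m B) 0 j) 0 in
  sq_h2norm S = l%:E /\ expected_power S l.
Proof.
move=> p1B S l.
have -> : l = \sum_(i < n | (0 < i)%N) alpha * lambda i.+1 * \sum_(j < m)
    mode_loss (k * lambda i.+1) tau 1 1 0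
      ((row_mx 0 (row_mx (row i U) 0) *m B) 0 j) (((0 : 'rV_(n + (n + 1))) *m B) 0 j).
  apply: eq_bigr => i _; congr (_ * _); apply: eq_bigr => j _.
  by rewrite [(0 *m B) 0 j](_ : _ = 0)// mul0mx mxE.
apply: (@modal_h2 R _ (fun i : 'I_n => 0 < i)%N _ _ _ S tau 1 0
  (fun i => k * lambda i.+1) (fun => 1)
  (fun i => alpha * lambda i.+1) (fun i => row_mx (row i U) (row_mx 0 0))) => //.
- by rewrite expr0n.
- by move=> i i0; rewrite mulr_gt0 ?lam_gt0.
- move=> i _; rewrite /= mulmxA mul_row3_invmx ?oner_neq0// mul_row3_block3.
  by rewrite !scaler0 !mul0mx !mulmx0 !addr0 invr1 scale1r mulmx1.
- move=> i i0; rewrite /= mulmxA mul_row3_invmx ?oner_neq0// mul_row3_block3.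
  rewrite !scaler0 !mul0mx !addr0 !add0r -!scalemxAl !mulmxN row_kL rowU1// !mulmx1.
  rewrite !scale_row_mx !opp_row_mx !add_row_mx !scale_row_mx.
  by rewrite !(scaler0, oppr0, addr0, add0r, scale0r) scaleNr.
- by move=> i _; rewrite mul0mx !(oppr0, scale0r, scaler0, addr0).
- exact: (output_modes _ _ H0 HH UU UL lambda1).
Qed.

Let in1 (i : 'I_n) : row_mx (row i U) (row_mx 0 0) *m inB SC = 0.
Proof.
rewrite /= mulmxA mul_row3_invmx ?oner_neq0// !mul_row_col !mul_mx_row.
by rewrite !scaler0 !mul0mx !mulmx0 !add_row_mx !addr0 row_mx0.
Qed.

Let in2 (i : 'I_n) :
  row_mx 0 (row_mx (row i U) 0) *m inB SC = row_mx (tau^-1 *: row i U) 0.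
Proof.
rewrite /= mulmxA mul_row3_invmx ?oner_neq0// !mul_row_col !mul_mx_row.
by rewrite !scaler0 !mul0mx !mulmx0 !add_row_mx !addr0 !add0r mulmx1.
Qed.

Let lossC := alpha / (2 * k) * (n%:R - 1).

Let sumP (i : 'I_n) : (0 < i)%N -> alpha * lambda i.+1 * \sum_(j < n)
   mode_loss (k * lambda i.+1) tau 1 1 0 ((tau^-1 *: row i U) 0 j) 0 =
   alpha / (2 * k).
Proof.
move=> i0; have l0 := lam_gt0 i0.
transitivity (alpha * lambda i.+1 * mode_loss (k * lambda i.+1) tau 1 1 0 tau^-1 0).
  rewrite -(sum_mode_loss _ _ _ _ _ _ _ (row_orthonormal i UU)); congr (_ * _).
  by apply: eq_bigr => j _; rewrite !mxE mul0r.
rewrite mode_loss_uncoupled ?mulr_gt0//; field.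
by rewrite !gt_eqF.
Qed.

Hypothesis n2 : (2 <= n)%N.

Let lossCE : lossC = \sum_(i < n | (0 < i)%N) alpha / (2 * k).
Proof.
rewrite -(big_nat_modes n (fun=> alpha / (2 * k))) sumr_const_nat subSS.
by rewrite -[RHS]mulr_natr natrB// ltnW.
Qed.

Lemma capi_power_loss :
  sq_h2norm (channel1 SC) = lossC%:E /\ expected_power (channel1 SC) lossC.
Proof.
have := @capi_modal _ (lsubmx (inB SC)); set l := \sum_(i < n | _) _ => h.
have <- : l = lossC.
  rewrite lossCE; apply: eq_bigr => i i0.
  by rewrite -[RHS](sumP i0) mulmx_lsub in2 row_mxKl.
by apply: h => i _; rewrite mulmx_lsub in1 linear0.
Qed.

Let mode_loss0 kap : mode_loss kap tau 1 1 0 0 0 = 0.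
Proof. by rewrite /mode_loss !(mulr0, expr0n, mul0r, addr0). Qed.

Lemma capi_measurement_loss :
  sq_h2norm (channel2 SC) = 0%E /\ expected_power (channel2 SC) 0.
Proof.
have := @capi_modal _ (rsubmx (inB SC)); set l := \sum_(i < n | _) _ => h.
have l0 : l = 0.
  apply: big1 => i i0; rewrite big1 ?mulr0// => j _.
  by rewrite mulmx_rsub in2 row_mxKr mxE mode_loss0.
suff : sq_h2norm (channel2 SC) = l%:E /\ expected_power (channel2 SC) l by rewrite l0.
by apply: h => i _; rewrite mulmx_rsub in1 linear0.
Qed.

Lemma capi_total_loss :
  sq_h2norm SC = lossC%:E /\ expected_power SC lossC.
Proof.
have := @capi_modal _ (inB SC); set l := \sum_(i < n | _) _ => h.
have <- : l = lossC.
  rewrite lossCE; apply: eq_bigr => i i0.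
  rewrite -[RHS](sumP i0) in2 big_split_ord /= [X in _ + X]big1 ?addr0.
    by congr (_ * _); apply: eq_bigr => j _; rewrite row_mxEl.
  by move=> j _; rewrite row_mxEr mxE mode_loss0.
by apply: h => i _; exact: in1.
Qed.
End centralized.
End network.

Theorem theorem3p1 (R : realType) (n : nat) (hn : (2 <= n)%N)
  (EP EC : rel 'I_n)
  (hEP : simple_graph EP) (hEPconn : connected_graph EP)
  (hEC : simple_graph EC)
  (b g c : 'M[R]_n)
  (hb : edge_weights EP b) (hg : edge_weights EP g) (hc : edge_weights EC c)
  (T Q K LGhalf : 'M[R]_n)
  (alpha tau q k gamma eps : R)
  (halpha : 0 < alpha) (htau : 0 < tau) (hq : 0 < q) (hk : 0 < k)
  (hgamma : 0 < gamma) (heps : 0 < eps)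
  (hLG : laplacian g = alpha *: laplacian b)
  (hT : T = tau%:M) (hQ : Q = q%:M) (hK : K = k%:M)
  (hLC : laplacian c = gamma *: laplacian b)
  (hLGhalf : psd_sqrt (laplacian g) LGhalf)
  (lambda : nat -> R) (hlambda : ordered_spectrum (laplacian b) lambda) :
  let SD := dapi T Q K (laplacian b) (laplacian c) LGhalf eps in
  let SC := capi T K (laplacian b) LGhalf q eps in
  let lossP := alpha / (2 * k) *
    \sum_(2 <= i < n.+1) 1 / (1 + (phi (lambda i) gamma k q tau)^-1) in
  let lossEta := eps ^+ 2 * (alpha / (2 * k)) *
    \sum_(2 <= i < n.+1)
      1 / (gamma * lambda i) * (1 / (1 + phi (lambda i) gamma k q tau)) in
  let lossC := alpha / (2 * k) * (n%:R - 1) in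
  [/\ lambda 1%N = 0 /\ 0 < lambda 2%N,
      [/\ sq_h2norm SD = (sq_h2norm (channel1 SD) + sq_h2norm (channel2 SD))%E,
          sq_h2norm (channel1 SD) = lossP%:E
        & sq_h2norm (channel2 SD) = lossEta%:E],
      [/\ sq_h2norm SC = sq_h2norm (channel1 SC),
          sq_h2norm (channel1 SC) = lossC%:E
        & sq_h2norm (channel2 SC) = 0%E],
      [/\ expected_power SD (lossP + lossEta),
          expected_power (channel1 SD) lossP
        & expected_power (channel2 SD) lossEta]
    & [/\ expected_power SC lossC,
          expected_power (channel1 SC) lossC
        & expected_power (channel2 SC) 0]].
Proof.
have [l1 lpos [U [UU UL U1]]] := laplacian_modes hn hEPconn hb hlambda.
have [H0 HH] := hLGhalf; rewrite hLG in HH.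
subst T Q K; rewrite hLC => SD SC lossP lossEta lossC.
have [DP1 DP2] := dapi_power_loss eps htau hq hk hgamma H0 HH UU UL l1 lpos.
have [DE1 DE2] := dapi_measurement_loss eps htau hq hk hgamma H0 HH UU UL l1 lpos.
have [D1 D2] := dapi_total_loss eps htau hq hk hgamma H0 HH UU UL l1 lpos.
have [CP1 CP2] := capi_power_loss eps htau hq hk H0 HH UU UL l1 lpos U1 hn.
have [CE1 CE2] := capi_measurement_loss eps htau hq hk H0 HH UU UL l1 lpos U1.
have [C1 C2] := capi_total_loss eps htau hq hk H0 HH UU UL l1 lpos U1 hn.
split.
- by split=> //; apply: lpos; rewrite leqnn.
- by split=> //; rewrite DP1 DE1 -EFinD.
- by split=> //; rewrite C1 CP1.
- by split.
- by split.
Qed.
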